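(* Let $\mathcal{H}$ be a separable right quaternionic Hilbert space with orthonormal bases indexed by $\mathbb{N}$, and let $T\in\mathcal{B}(\mathcal{H})$ be a normal operator. Then $$\overline{B^+(T)}=\mathrm{conv}\,\{\sigma_S^+(T),\ \underline{v},\ \overline{v}\},$$ where $\underline{v}=\inf\,(B(T)\cap\mathbb{R})$, $\overline{v}=\sup\,(B(T)\cap\mathbb{R})$, and the right-hand side denotes the convex hull of $\sigma_S^+(T)\cup\{\underline{v},\overline{v}\}$.
   Context: $\mathbb{H}$ denotes the real quaternions with basis $\{1,i,j,k\}$, $\mathbb{C}=\mathrm{span}_{\mathbb{R}}\{1,i\}\subset\mathbb{H}$, and $\mathbb{C}^+$ is the closed upper half-plane of $\mathbb{C}$. $\mathcal{H}$ is a right quaternionic Hilbert space with inner product $\langle\cdot,\cdot\rangle$ that is right $\mathbb{H}$-linear in the first variable, satisfies $\langle x,y\rangle=\langle y,x\rangle^*$ and is positive definite; $\mathcal{H}$ is separable, with countable orthonormal bases indexed by $\mathbb{N}$. $\mathcal{B}(\mathcal{H})$ is the set of bounded right $\mathbb{H}$-linear operators on $\mathcal{H}$; $T$ is normal if $T^*T=TT^*$. The quaternionic numerical range is $W(T)=\{\langle Tx,x\rangle:x\in\mathcal{H},\|x\|=1\}\subset\mathbb{H}$; the bild is $B(T)=W(T)\cap\mathbb{C}$ and the upper bild is $B^+(T)=W(T)\cap\mathbb{C}^+$. For $q\in\mathbb{H}$ put $\Delta_q(T)=T^2-2\,\mathrm{Re}(q)\,T+|q|^2 I$; the S-spectrum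 is $\sigma_S(T)=\{q\in\mathbb{H}:\Delta_q(T)\text{ is not invertible in }\mathcal{B}(\mathcal{H})\}$, and $\sigma_S^+(T)=\sigma_S(T)\cap\mathbb{C}^+$. *)

(* Defs.v *)
From HB Require Import structures.
From mathcomp Require Import all_boot all_order all_algebra.
From mathcomp Require Import ring lra.
From mathcomp Require Import all_classical all_reals all_analysis.

Set Implicit Arguments.
Unset Strict Implicit.
Unset Printing Implicit Defensive.

Import Order.TTheory GRing.Theory Num.Theory.
Import numFieldNormedType.Exports.

Local Open Scope classical_set_scope.
Local Open Scope ring_scope.

(* [Quat a b c d] is a + b i + c j + d k. *)
Record quaternion (R : realType) :=
  Quat { qre : R; qi : R; qj : R; qk : R }.

Section quaternion_algebra.
Context {R : realType}.
Implicit Types (a b : R) (p q r : quaternion R).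

Lemma quatP p q :
  qre p = qre q -> qi p = qi q -> qj p = qj q -> qk p = qk q -> p = q.
Proof. by case: p q => [? ? ? ?] [? ? ? ?] /= -> -> -> ->. Qed.

Definition quat_to_prod q : R * R * R * R := (qre q, qi q, qj q, qk q).
Definition prod_to_quat (x : R * R * R * R) : quaternion R :=
  Quat x.1.1.1 x.1.1.2 x.1.2 x.2.
Lemma quat_to_prodK : cancel quat_to_prod prod_to_quat.
Proof. by case. Qed.

HB.instance Definition _ := Choice.copy (quaternion R) (can_type quat_to_prodK).

Definition quat_add p q :=
  Quat (qre p + qre q) (qi p + qi q) (qj p + qj q) (qk p + qk q).
Definition quat_opp q := Quat (- qre q) (- qi q) (- qj q) (- qk q).
Definition quat_zero : quaternion R := Quat 0 0 0 0.

Fact quat_addA : associative quat_add.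
Proof. by move=> *; apply: quatP; rewrite /= addrA. Qed.
Fact quat_addC : commutative quat_add.
Proof. by move=> *; apply: quatP; rewrite /= addrC. Qed.
Fact quat_add0 : left_id quat_zero quat_add.
Proof. by move=> *; apply: quatP; rewrite /= add0r. Qed.
Fact quat_addN : left_inverse quat_zero quat_opp quat_add.
Proof. by move=> *; apply: quatP; rewrite /= addNr. Qed.

HB.instance Definition _ :=
  GRing.isZmodule.Build (quaternion R) quat_addA quat_addC quat_add0 quat_addN.

Definition qreal a : quaternion R := Quat a 0 0 0.

(* Hamilton product: i^2 = j^2 = k^2 = ijk = -1. *)
Definition quat_mul p q := Quat
  (qre p * qre q - qi p * qi q - qj p * qj q - qk p * qk q)
  (qre p * qi q + qi p * qre q + qj p * qk q - qk p * qj q)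
  (qre p * qj q - qi p * qk q + qj p * qre q + qk p * qi q)
  (qre p * qk q + qi p * qj q - qj p * qi q + qk p * qre q).

Fact quat_mulA : associative quat_mul.
Proof. by move=> *; apply: quatP => /=; ring. Qed.
Fact quat_mul1l : left_id (qreal 1) quat_mul.
Proof. by move=> *; apply: quatP => /=; ring. Qed.
Fact quat_mul1r : right_id (qreal 1) quat_mul.
Proof. by move=> *; apply: quatP => /=; ring. Qed.
Fact quat_mulDl : left_distributive quat_mul quat_add.
Proof. by move=> *; apply: quatP => /=; ring. Qed.
Fact quat_mulDr : right_distributive quat_mul quat_add.
Proof. by move=> *; apply: quatP => /=; ring. Qed.
Fact quat_one_neq0 : qreal 1 != 0.
Proof. by apply/eqP => -[/eqP]; rewrite oner_eq0. Qed.

HB.instance Definition _ := GRing.Zmodule_isNzRing.Build (quaternion R)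
  quat_mulA quat_mul1l quat_mul1r quat_mulDl quat_mulDr quat_one_neq0.

Definition quat_conj q := Quat (qre q) (- qi q) (- qj q) (- qk q).

Definition quat_scale a q := Quat (a * qre q) (a * qi q) (a * qj q) (a * qk q).

Fact quat_scaleA a b q : quat_scale a (quat_scale b q) = quat_scale (a * b) q.
Proof. by apply: quatP; rewrite /= mulrA. Qed.
Fact quat_scale1 : left_id 1 quat_scale.
Proof. by move=> *; apply: quatP; rewrite /= mul1r. Qed.
Fact quat_scaleDr : right_distributive quat_scale +%R.
Proof. by move=> *; apply: quatP; rewrite /= mulrDr. Qed.
Fact quat_scaleDl q : {morph quat_scale^~ q : a b / a + b}.
Proof. by move=> *; apply: quatP; rewrite /= mulrDl. Qed.

HB.instance Definition _ := GRing.Zmodule_isLmodule.Build R (quaternion R)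
  quat_scaleA quat_scale1 quat_scaleDr quat_scaleDl.

Definition quat_norm q : R :=
  Num.sqrt (qre q ^+ 2 + qi q ^+ 2 + qj q ^+ 2 + qk q ^+ 2).

Let sqnorm_ge0 q : 0 <= qre q ^+ 2 + qi q ^+ 2 + qj q ^+ 2 + qk q ^+ 2.
Proof. by rewrite !addr_ge0// sqr_ge0. Qed.

Fact quat_norm_triangle p q : quat_norm (p + q) <= quat_norm p + quat_norm q.
Proof.
rewrite -ler_sqr ?nnegrE ?addr_ge0 ?sqrtr_ge0// sqrrD !sqr_sqrtr//.
set P := (X in _ <= X + _ + _); set Q := (X in _ <= _ + X).
suff : qre p * qre q + qi p * qi q + qj p * qj q + qk p * qk q
    <= quat_norm p * quat_norm q.
  by rewrite /P /Q /= -/(quat_norm p) -/(quat_norm q); lra.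
apply: le_trans (ler_norm _) _.
rewrite -ler_sqr ?nnegrE ?mulr_ge0 ?sqrtr_ge0//.
rewrite real_normK ?num_real// exprMn !sqr_sqrtr//.
rewrite -subr_ge0 [leRHS](_ : _ =
  (qre p * qi q - qi p * qre q) ^+ 2 + (qre p * qj q - qj p * qre q) ^+ 2 +
  (qre p * qk q - qk p * qre q) ^+ 2 + (qi p * qj q - qj p * qi q) ^+ 2 +
  (qi p * qk q - qk p * qi q) ^+ 2 + (qj p * qk q - qk p * qj q) ^+ 2).
  by rewrite !addr_ge0// sqr_ge0.
by ring.
Qed.

Fact quat_normZ a q : quat_norm (a *: q) = `|a| * quat_norm q.
Proof.
rewrite /quat_norm -sqrtr_sqr -sqrtrM ?sqr_ge0//; congr Num.sqrt.
by rewrite /=; ring.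
Qed.

Fact quat_norm_eq0 q : quat_norm q = 0 -> q = 0.
Proof.
move/eqP; rewrite sqrtr_eq0 => q0.
have := sqr_ge0 (qre q); have := sqr_ge0 (qi q).
have := sqr_ge0 (qj q); have := sqr_ge0 (qk q) => d c b a.
by apply: quatP; apply/eqP; rewrite -(sqrf_eq0 (_ q)) eq_le /=; lra.
Qed.

HB.instance Definition _ := Lmodule_isNormed.Build R (quaternion R)
  quat_norm_triangle quat_normZ quat_norm_eq0.

End quaternion_algebra.

Section complex_subsets.
Context {R : realType}.

Definition complex_plane : set (quaternion R) :=
  [set q | qj q = 0 /\ qk q = 0].

Definition upper_half_plane : set (quaternion R) :=
  complex_plane `&` [set q | 0 <= qi q].

End complex_subsets.

(* The carrier is a real Banach space. The last axiom and [rscale_real] say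
   that its norm and its real scaling are those induced by the quaternionic
   inner product and by right multiplication by real quaternions, so that
   completeness is completeness for the inner product norm. *)
HB.mixin Record isRightQuaternionicHilbert (R : realType) V
    & CompleteNormedModule R V := {
  rscale : V -> quaternion R -> V;
  inner : V -> V -> quaternion R;
  rscaleDl : forall x y q, rscale (x + y) q = rscale x q + rscale y q;
  rscaleDr : forall x p q, rscale x (p + q) = rscale x p + rscale x q;
  rscaleA : forall x p q, rscale (rscale x p) q = rscale x (p * q);
  rscale_real : forall x (a : R), rscale x (qreal a) = a *: x;
  innerDl : forall x y z, inner (x + y) z = inner x z + inner y z;
  innerZl : forall x y q, inner (rscale x q) y = inner x y * q;
  inner_conj : forall x y, inner x y = quat_conj (inner y x);
  inner_norm : forall x, inner x x = qreal (`|x| ^+ 2)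
}.

#[short(type="rightQuaternionicHilbertType")]
HB.structure Definition RightQuaternionicHilbert (R : realType) :=
  {V of isRightQuaternionicHilbert R V & CompleteNormedModule R V}.

Section operators.
Context {R : realType} {H : rightQuaternionicHilbertType R}.
Implicit Types (T S : H -> H) (e : nat -> H) (q : quaternion R).

(* [inner] is linear in its first argument, so the coordinate of [x] along
   [e n] is [inner x (e n)]; it multiplies [e n] on the right. *)
Definition orthonormal_basis e : Prop :=
  (forall m n, inner (e m) (e n) = (m == n)%:R) /\
  (forall x, series (fun n => rscale (e n) (inner x (e n))) @ \oo --> x).

Definition right_linear T : Prop :=
  (forall x y, T (x + y) = T x + T y) /\
  (forall x q, T (rscale x q) = rscale (T x) q).

Definition bounded_operators : set (H -> H) :=
  [set T | right_linear T /\ exists M : R, forall x, `|T x| <= M * `|x|].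

Definition adjoint_of T S : Prop := forall x y, inner (T x) y = inner x (S y).

(* For bounded [T] such an [S] exists by Riesz representation, is unique and
   bounded: it is the adjoint of [T]. *)
Definition normal_operator T : Prop :=
  exists2 S, adjoint_of T S & S \o T = T \o S.

Definition invertible_operator T : Prop :=
  exists2 S, bounded_operators S & S \o T = id /\ T \o S = id.

Definition numerical_range T : set (quaternion R) :=
  [set inner (T x) x | x in [set x : H | `|x| = 1]].

Definition bild T := numerical_range T `&` complex_plane.

Definition upper_bild T := numerical_range T `&` upper_half_plane.

Definition real_bild T : set R := [set a | bild T (qreal a)].

Definition Delta q T : H -> H :=
  fun x => T (T x) - (2 * qre q) *: T x + `|q| ^+ 2 *: x.

Definition S_spectrum T : set (quaternion R) :=
  [set q | ~ invertible_operator (Delta q T)].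

Definition upper_S_spectrum T := S_spectrum T `&` upper_half_plane.

End operators.

Definition convex_hull {R : realType} {E : lmodType R} (A : set E) : set E :=
  smallest (@convex_set R E) A.

(* Main.v *)
Require Import Defs.
From HB Require Import structures.
From mathcomp Require Import all_boot all_order all_algebra.
From mathcomp Require Import ring lra.
From mathcomp Require Import all_classical all_reals all_analysis.
Set Implicit Arguments.
Unset Strict Implicit.
Unset Printing Implicit Defensive.

Import Order.TTheory GRing.Theory Num.Theory.
Import numFieldNormedType.Exports.

Local Open Scope classical_set_scope.
Local Open Scope ring_scope.

(* Split T x = A x + (D x) i, where A and D are commuting and self-adjoint for
   the real inner product. A point a + b i of the upper half-plane is in the
   S-spectrum iff it is an approximate eigenvalue, so that joint approximate
   eigenvalues (a, b) of A and D yield the points a + |b| i of the S-spectrum.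

   The hull is in the closure: an approximate eigenvector x for p is almost
   decoupled from the orthogonal complement of x H. Writing a unit vector y as
   x h + y' with y' orthogonal to x, and changing the modulus and the phase of
   the quaternion h, one moves the value of y along a segment to p. Hence the
   closure of the upper bild is star-shaped around each point of the S-spectrum,
   and thus around each point of its convex hull. The segment from the infimum
   to the supremum of the real values is in the closure as well, because the set
   of real values is an interval.

   The closure is in the hull: by Caratheodory the hull is compact, so that it
   is an intersection of half-planes al a + be b <= m. If be >= 0, the supremum
   of the form is attained on the joint spectrum of A and D. If be < 0, let la be
   the supremum of al Re q + be |Im q| for q in the numerical range. If |Im q| is
   bounded away from 0 along almost maximisers x, their first variation shows that
   (al A + be D) x is close to la x, whence a point of the S-spectrum on the line
   al a + be b = la. If |Im q| tends to 0, either x is close to a vector with a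
   real value, or D x tends to 0 and one gets again a point of the S-spectrum. *)

(** * Quaternions *)

Lemma le_small_eq0 {R : realType} (a C : R) :
  (forall d, 0 < d -> `|a| <= C * d) -> a = 0.
Proof.
move=> small; apply/eqP; rewrite -normr_eq0 eq_le normr_ge0 andbT leNgt.
apply/negP => a0; have C0 : 0 < C.
  by have := small 1 ltr01; rewrite mulr1; exact: lt_le_trans.
have := small (`|a| / (2 * C)); rewrite divr_gt0// ?mulr_gt0// => /(_ isT).
rewrite (_ : C * _ = `|a| / 2); last by field; rewrite gt_eqF.
lra.
Qed.

Section quaternion_theory.
Context {R : realType}.
Implicit Types (a b : R) (p q e g h u v w : quaternion R).

Definition cplx a b : quaternion R := Quat a b 0 0.

Definition quat_im q : quaternion R := Quat 0 (qi q) (qj q) (qk q).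

Definition imn q : R := `|quat_im q|.

Lemma sqr_normq q : `|q| ^+ 2 = qre q ^+ 2 + qi q ^+ 2 + qj q ^+ 2 + qk q ^+ 2.
Proof. by rewrite sqr_sqrtr// !addr_ge0// sqr_ge0. Qed.

Lemma sqr_imn q : imn q ^+ 2 = qi q ^+ 2 + qj q ^+ 2 + qk q ^+ 2.
Proof. by rewrite sqr_normq /=; ring. Qed.

Lemma imn_ge0 q : 0 <= imn q.
Proof. exact: normr_ge0. Qed.

Lemma sqr_inj_ge0 a b : 0 <= a -> 0 <= b -> a ^+ 2 = b ^+ 2 -> a = b.
Proof. by move=> a0 b0 /eqP; rewrite eqrXn2// => /eqP. Qed.

Lemma normqM p q : `|p * q| = `|p| * `|q|.
Proof.
apply: sqr_inj_ge0; rewrite ?mulr_ge0//.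
by rewrite exprMn !sqr_normq /=; ring.
Qed.

Lemma normq_conj q : `|quat_conj q| = `|q|.
Proof. by apply: sqr_inj_ge0 => //; rewrite !sqr_normq /=; ring. Qed.

Lemma normq_real a : `|qreal a| = `|a|.
Proof.
apply: sqr_inj_ge0 => //; rewrite real_normK ?num_real// sqr_normq /=.
by ring.
Qed.

Lemma quat_conjM p q : quat_conj (p * q) = quat_conj q * quat_conj p.
Proof. by apply: quatP => /=; ring. Qed.

Lemma quat_conjD p q : quat_conj (p + q) = quat_conj p + quat_conj q.
Proof. by apply: quatP => /=; ring. Qed.

Lemma quat_conjK : involutive (@quat_conj R).
Proof. by move=> q; apply: quatP => /=; ring. Qed.

Lemma mulq_conj q : q * quat_conj q = qreal (`|q| ^+ 2).
Proof. by rewrite sqr_normq; apply: quatP => /=; ring. Qed.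

Lemma mulqr a q : q * qreal a = a *: q.
Proof. by apply: quatP => /=; ring. Qed.

Lemma mulrq a q : qreal a * q = a *: q.
Proof. by apply: quatP => /=; ring. Qed.

Lemma scaleqAr a p q : p * (a *: q) = a *: (p * q).
Proof. by apply: quatP => /=; ring. Qed.

Lemma scaleqAl a p q : (a *: p) * q = a *: (p * q).
Proof. by apply: quatP => /=; ring. Qed.

Lemma quat_right_inv q : q != 0 -> exists2 p, q * p = 1 & `|p| = `|q|^-1.
Proof.
move=> q0; have n0 : `|q| != 0 by rewrite normr_eq0.
exists (`|q| ^- 2 *: quat_conj q).
  rewrite scaleqAr mulq_conj; apply: quatP => /=; rewrite ?mulr0//.
  by rewrite mulVf// expf_neq0.
by rewrite normrZ normq_conj normfV normrX normr_id; field.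
Qed.

Lemma abs_qre_le q : `|qre q| <= `|q|.
Proof.
rewrite -ler_sqr ?nnegrE// sqr_normq real_normK ?num_real//.
by have := sqr_ge0 (qi q); have := sqr_ge0 (qj q); have := sqr_ge0 (qk q); lra.
Qed.

Lemma abs_qi_le q : `|qi q| <= `|q|.
Proof.
rewrite -ler_sqr ?nnegrE// sqr_normq real_normK ?num_real//.
by have := sqr_ge0 (qre q); have := sqr_ge0 (qj q); have := sqr_ge0 (qk q); lra.
Qed.

Lemma abs_qj_le q : `|qj q| <= `|q|.
Proof.
rewrite -ler_sqr ?nnegrE// sqr_normq real_normK ?num_real//.
by have := sqr_ge0 (qre q); have := sqr_ge0 (qi q); have := sqr_ge0 (qk q); lra.
Qed.

Lemma abs_qk_le q : `|qk q| <= `|q|.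
Proof.
rewrite -ler_sqr ?nnegrE// sqr_normq real_normK ?num_real//.
by have := sqr_ge0 (qre q); have := sqr_ge0 (qi q); have := sqr_ge0 (qj q); lra.
Qed.

Lemma imn_le q : imn q <= `|q|.
Proof.
rewrite -ler_sqr ?nnegrE ?imn_ge0// sqr_imn sqr_normq.
by have := sqr_ge0 (qre q); lra.
Qed.

Lemma quat_imB p q : quat_im p - quat_im q = quat_im (p - q).
Proof. by apply: quatP; rewrite //= subr0. Qed.

Lemma imn_lipschitz p q : `|imn p - imn q| <= `|p - q|.
Proof.
by apply: le_trans (ler_dist_dist _ _) _; rewrite quat_imB; exact: imn_le.
Qed.

Lemma normq_cplx_le a b : `|cplx a b| <= `|a| + `|b|.
Proof.
rewrite -ler_sqr ?nnegrE ?addr_ge0// sqr_normq /= sqrrD !real_normK ?num_real//.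
by rewrite expr0n/= !addr0 lerD2r lerDl mulrn_wge0// mulr_ge0.
Qed.

Lemma quat_conjZ a q : quat_conj (a *: q) = a *: quat_conj q.
Proof. by apply: quatP => /=; ring. Qed.

Lemma imnZ a q : imn (a *: q) = `|a| * imn q.
Proof.
rewrite /imn -normrZ; congr `|_|.
by apply: quatP; rewrite //= mulr0.
Qed.

(** The square of the right-hand side exceeds [imn q ^+ 2] by the square of the fraction. So [imn]
    and [qi] agree to second order near a complex point with positive [qi]. *)
Lemma imn_le_qi q : 0 < qi q ->
  imn q <= qi q + (qj q ^+ 2 + qk q ^+ 2) / (2 * qi q).
Proof.
move=> q0; set s := _ / _; have s0 : 0 <= s.
  by rewrite divr_ge0 ?addr_ge0 ?sqr_ge0 ?mulr_ge0// ltW.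
rewrite -ler_sqr ?nnegrE ?imn_ge0 ?addr_ge0 ?(ltW q0)// sqr_imn.
have : 2 * qi q * s = qj q ^+ 2 + qk q ^+ 2.
  by rewrite mulrC divfK// gt_eqF// mulr_gt0.
by have := sqr_ge0 s; lra.
Qed.

(* The pure imaginary [n] of norm 1 satisfies [n * n = -1], whence
   [n * (1 - n * i) = n + i = (1 - n * i) * i]. *)
Lemma rotate_to_cplx q : exists2 u, `|u| = 1 &
  quat_conj u * q * u = cplx (qre q) (imn q).
Proof.
suff [u u0 qu] : exists2 u, u != 0 & q * u = u * cplx (qre q) (imn q).
  have n0 : `|u| != 0 by rewrite normr_eq0.
  exists (`|u|^-1 *: u); first by rewrite normrZ normfV normr_id mulVf.
  rewrite quat_conjZ scaleqAr !scaleqAl -mulrA qu mulrA.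
  have -> : quat_conj u * u = qreal (`|u| ^+ 2).
    by rewrite sqr_normq; apply: quatP => /=; ring.
  rewrite mulrq !scalerA [X in X *: _](_ : _ = 1) ?scale1r//.
  by field.
have [/eqP m0|m0] := eqVneq (imn q) 0.
  exists 1; first exact: oner_neq0.
  have : imn q ^+ 2 = 0 by rewrite (eqP m0) expr0n.
  rewrite sqr_imn => s0.
  have := sqr_ge0 (qi q); have := sqr_ge0 (qj q); have := sqr_ge0 (qk q).
  move=> k0 j0 i0.
  have [qi0 [qj0 qk0]] : qi q = 0 /\ qj q = 0 /\ qk q = 0.
    by split; [|split]; apply/eqP; rewrite -sqrf_eq0; apply/eqP; lra.
  by rewrite mulr1 mul1r (eqP m0); apply: quatP.
pose m := imn q; have mq := sqr_imn q.
(* When the imaginary part is [- m i], the general witness below vanishes; conjugation by [j] sends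
   [- i] to [i]. *)
have [j0|] := pselect (qi q = - m /\ qj q = 0 /\ qk q = 0).
  case: j0 => qim [qj0 qk0]; exists (Quat 0 0 1 0).
    by apply/eqP => -[/eqP]; rewrite oner_eq0.
  by apply: quatP; rewrite /= qim qj0 qk0 -/m; ring.
move=> nj; exists (qreal m - quat_im q * cplx 0 1).
  apply/eqP => u0; apply: nj.
  have := congr1 (@qre R) u0; have := congr1 (@qj R) u0.
  by have := congr1 (@qk R) u0; rewrite /=; split; [|split]; lra.
by apply: quatP; rewrite /= -/m; rewrite -/m in mq; ring: mq.
Qed.

End quaternion_theory.

(** * Real inner product and approximate eigenvalues *)

Section hilbert_theory.
Context {R : realType} {H : rightQuaternionicHilbertType R}.
Implicit Types (x y z : H) (a b : R) (p q : quaternion R).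

Lemma rscaleZl a x q : rscale (a *: x) q = a *: rscale x q.
Proof. by rewrite -!rscale_real !rscaleA mulqr mulrq. Qed.

Lemma rscaleZr a x q : rscale x (a *: q) = a *: rscale x q.
Proof. by rewrite -!rscale_real !rscaleA mulqr. Qed.

Definition rmul q x : H := rscale x q.

Fact rmul_linear q : linear (rmul q).
Proof. by move=> a x y; rewrite /rmul rscaleDl rscaleZl. Qed.

HB.instance Definition _ q := GRing.isLinear.Build R H H *:%R (rmul q) (rmul_linear q).

Lemma rscaleNl x q : rscale (- x) q = - rscale x q.
Proof. exact: (linearN (rmul q)). Qed.

Lemma rscaleBl x y q : rscale (x - y) q = rscale x q - rscale y q.
Proof. exact: (linearB (rmul q)). Qed.

Lemma rscaleNr x q : rscale x (- q) = - rscale x q.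
Proof. by rewrite -scaleN1r rscaleZr scaleN1r. Qed.

Lemma rscaleBr x p q : rscale x (p - q) = rscale x p - rscale x q.
Proof. by rewrite rscaleDr rscaleNr. Qed.

Lemma innerZ a x y : inner (a *: x) y = a *: inner x y.
Proof. by rewrite -rscale_real innerZl mulqr. Qed.

Lemma innerNl x y : inner (- x) y = - inner x y.
Proof. by rewrite -scaleN1r innerZ scaleN1r. Qed.

Lemma innerBl x y z : inner (x - y) z = inner x z - inner y z.
Proof. by rewrite innerDl innerNl. Qed.

Lemma inner0l y : inner (0 : H) y = 0.
Proof. by rewrite -(scale0r (0 : H)) innerZ scale0r. Qed.

Lemma innerDr x y z : inner x (y + z) = inner x y + inner x z.
Proof. by rewrite inner_conj innerDl quat_conjD -!inner_conj. Qed.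

Lemma innerZr x y q : inner x (rscale y q) = quat_conj q * inner x y.
Proof. by rewrite inner_conj innerZl quat_conjM -inner_conj. Qed.

Lemma inner_scaler a x y : inner x (a *: y) = a *: inner x y.
Proof. by rewrite inner_conj innerZ [in RHS]inner_conj; apply: quatP => /=; ring. Qed.

Lemma innerNr x y : inner x (- y) = - inner x y.
Proof. by rewrite -scaleN1r inner_scaler scaleN1r. Qed.

Lemma innerBr x y z : inner x (y - z) = inner x y - inner x z.
Proof. by rewrite innerDr innerNr. Qed.

Definition rdot x y : R := qre (inner x y).

Lemma rdotC x y : rdot x y = rdot y x.
Proof. by rewrite /rdot inner_conj. Qed.

Lemma rdotDl x y z : rdot (x + y) z = rdot x z + rdot y z.
Proof. by rewrite /rdot innerDl. Qed.

Lemma rdotDr x y z : rdot x (y + z) = rdot x y + rdot x z.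
Proof. by rewrite /rdot innerDr. Qed.

Lemma rdotZl a x y : rdot (a *: x) y = a * rdot x y.
Proof. by rewrite /rdot innerZ. Qed.

Lemma rdotZr a x y : rdot x (a *: y) = a * rdot x y.
Proof. by rewrite /rdot inner_scaler. Qed.

Lemma rdotNl x y : rdot (- x) y = - rdot x y.
Proof. by rewrite /rdot innerNl. Qed.

Lemma rdotNr x y : rdot x (- y) = - rdot x y.
Proof. by rewrite /rdot innerNr. Qed.

Lemma rdot_norm x : rdot x x = `|x| ^+ 2.
Proof. by rewrite /rdot inner_norm. Qed.

Definition rdotE := (rdotDl, rdotDr, rdotZl, rdotZr, rdotNl, rdotNr).

Lemma normrD_sqr x y : `|x + y| ^+ 2 = `|x| ^+ 2 + 2 * rdot x y + `|y| ^+ 2.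
Proof. by rewrite -!rdot_norm !rdotE (rdotC y x); ring. Qed.

Lemma rdot_cauchy x y : `|rdot x y| <= `|x| * `|y|.
Proof.
have [->|y0] := eqVneq y 0.
  by rewrite -(scale0r (0 : H)) rdotZr mul0r normr0 scale0r normr0 mulr0.
have n0 : 0 < `|y| by rewrite normr_gt0.
have := sqr_ge0 `|x - (rdot x y / `|y| ^+ 2) *: y|.
rewrite -[`|x - _| ^+ 2]rdot_norm !rdotE (rdotC y x) !rdot_norm => h.
rewrite -ler_sqr ?nnegrE ?mulr_ge0// real_normK ?num_real// exprMn.
rewrite -ler_pdivrMr ?exprn_gt0// -subr_ge0.
apply: le_trans h _; rewrite le_eqVlt; apply/orP; left; apply/eqP.
by field; rewrite gt_eqF.
Qed.

Lemma norm_rscale x q : `|rscale x q| = `|x| * `|q|.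
Proof.
apply: sqr_inj_ge0; rewrite ?mulr_ge0// -rdot_norm /rdot innerZr innerZl.
by rewrite inner_norm mulrq scaleqAr exprMn sqr_normq /=; ring.
Qed.

Lemma inner_cauchy x y : `|inner x y| <= `|x| * `|y|.
Proof.
have [->|n0] := eqVneq `|inner x y| 0; first by rewrite mulr_ge0.
(* This multiple of [x] has a real inner product with [y], so the real inequality suffices. *)
have := rdot_cauchy (rscale x (quat_conj (inner x y))) y.
rewrite /rdot innerZl mulq_conj norm_rscale normq_conj /= normrX normr_id.
by rewrite expr2 mulrAC ler_pM2r// lt_neqAle eq_sym n0/=.
Qed.

End hilbert_theory.

(** * Approximate eigenvalues by maximising a quadratic form *)

Section approximate_spectrum.
Context {R : realType} {H : rightQuaternionicHilbertType R}.
Implicit Types (x y z : H) (A : {linear H -> H}) (a b d eta eps : R).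

Definition bounded_by (K : R) (f : H -> H) : Prop := forall x, `|f x| <= K * `|x|.

Definition self_adjoint (f : H -> H) : Prop := forall x y, rdot (f x) y = rdot x (f y).

(* [N] is small on a sequence of unit vectors: such a sequence can be improved
   into approximate eigenvectors of [A] by maximising [rdot (A x) x] over all
   of them, since a first-order perturbation [x + t (A x - a x)] preserves the
   smallness of [N]. *)
Lemma approximate_eigenvalue A (K c : R) (N : H -> R) :
  bounded_by K A -> self_adjoint A ->
  (forall x y, N (x + y) <= N x + N y) ->
  (forall a x, N (a *: x) = `|a| * N x) ->
  (forall x, N (A x) <= K * N x) ->
  (forall d, 0 < d -> exists x, [/\ `|x| = 1, N x <= d & c - d <= rdot (A x) x]) ->
  exists2 a, c <= a & forall d, 0 < d ->
    exists x, [/\ `|x| = 1, N x <= d & `|A x - a *: x| <= d].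
Proof.
move=> AK Asym ND NZ NA Vc.
pose V := [set b | forall d, 0 < d ->
  exists x, [/\ `|x| = 1, N x <= d & b - d <= rdot (A x) x]].
have dotK x : `|x| = 1 -> rdot (A x) x <= K.
  move=> x1; apply: le_trans (ler_norm _) _; apply: le_trans (rdot_cauchy _ _) _.
  by have := AK x; rewrite x1 !mulr1.
have V_ub b : V b -> b <= K + 1.
  by move=> /(_ 1 ltr01)[x [x1 _ bx]]; have := dotK x x1; lra.
have V_sup : has_sup V by split; [exists c|exists (K + 1)].
pose a := sup V.
have Va : V a.
  move=> d d0; have d2 : 0 < d / 2 by lra.
  have [v Vv av] := sup_adherent d2 V_sup.
  have [x [x1 Nx vx]] := Vv _ d2.
  by exists x; split; rewrite // -/a in av *; lra.
exists a; first exact: (ub_le_sup V_sup.2).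
(* Otherwise [a + eta] would belong to [V], against the maximality of [a]. *)
have upper eta : 0 < eta -> exists2 d, 0 < d & forall z, N z <= d * `|z| ->
    rdot (A z) z <= (a + eta) * `|z| ^+ 2.
  move=> eta0; apply: contrapT => noub.
  suff : a + eta <= a by lra.
  apply: (ub_le_sup V_sup.2) => d d0; apply: contrapT => nox.
  apply: noub; exists d => // z Nz.
  have [->|z0] := eqVneq z 0.
    by rewrite linear0 rdot_norm normr0 expr0n mulr0.
  have n0 : 0 < `|z| by rewrite normr_gt0.
  rewrite leNgt; apply/negP => lt_z; apply: nox; exists (`|z|^-1 *: z); split.
  - by rewrite normrZ normfV normr_id mulVf ?gt_eqF.
  - by rewrite NZ normfV normr_id ler_pdivrMl// mulrC.
  - rewrite linearZ !rdotE mulrA -invfM -expr2 ler_pdivlMl ?exprn_gt0// mulrC.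
    apply: le_trans (ltW lt_z); rewrite ler_pM2r ?exprn_gt0//; lra.
move=> eps eps0; pose L := K + `|a|.
have K0 : 0 <= K.
  have [x [x1 _ _]] := Vc 1 ltr01.
  by have := AK x; rewrite x1 mulr1; apply: le_trans.
have L0 : 0 <= L by rewrite addr_ge0.
have L3 : 0 <= L ^+ 3 by rewrite exprn_ge0.
(* The first bound keeps the norm of [z = y + t w] between 1/2 and 3/2; the second bounds by
   [eps ^+ 2] the error left after division by [t]. *)
pose t := Num.min (2 * L + 1)^-1 (eps ^+ 2 / (5 + L ^+ 3)).
have t0 : 0 < t by rewrite lt_min invr_gt0 divr_gt0 ?exprn_gt0//; lra.
have tL : t * L <= 1 / 2.
  have : t <= (2 * L + 1)^-1 by rewrite ge_min lexx.
  by rewrite -[_^-1]mul1r ler_pdivlMr; lra.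
have teps : t * (5 + L ^+ 3) <= eps ^+ 2.
  by rewrite -ler_pdivlMr ?ge_min ?lexx ?orbT//; lra.
have tt : 0 < t ^+ 2 by rewrite exprn_gt0.
have [d d0 ub] := upper _ tt.
pose d1 := Num.min eps (Num.min (t ^+ 2) (d / 4)).
have d1_gt0 : 0 < d1 by rewrite !lt_min eps0 tt; lra.
have [d1eps [d1t d1d]] : d1 <= eps /\ d1 <= t ^+ 2 /\ d1 <= d / 4.
  by rewrite /d1 !ge_min !lexx !orbT.
have [y [y1 Ny ay]] := Va _ d1_gt0.
exists y; split; rewrite ?(le_trans Ny)//.
have [w Aye] : exists w, A y = w + a *: y by exists (A y - a *: y); rewrite subrK.
have -> : A y - a *: y = w by rewrite Aye addrK.
have wL x : `|A x - a *: x| <= L * `|x|.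
  rewrite mulrDl; apply: le_trans (ler_normB _ _) _.
  by rewrite normrZ lerD.
have Ny0 : 0 <= N y.
  have /(_ 0 0) := NZ; rewrite normr0 mul0r scaler0 => N0.
  by have := ND y (- y); rewrite subrr N0 -scaleN1r NZ normrN1; lra.
pose z := y + t *: w.
have wy : `|w| <= L by have := wL y; rewrite y1 mulr1 Aye addrK.
have nw : 0 <= `|w| by [].
have tw : `|t *: w| <= 1 / 2.
  by rewrite normrZ gtr0_norm//; apply: le_trans tL; rewrite ler_pM2l.
have z_le : `|z| <= 3 / 2 by have := ler_normD y (t *: w); rewrite -/z y1; lra.
have z_ge : 1 / 2 <= `|z|.
  have := lerB_normD y (t *: w); rewrite y1 -/z; lra.
have Nz : N z <= d * `|z|.
  have Nw : N w <= L * N y.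
    have -> : w = A y - a *: y by rewrite Aye addrK.
    rewrite mulrDl; apply: le_trans (ND _ _) _.
    by rewrite -scaleNr NZ normrN lerD.
  have : N z <= N y + t * (L * N y).
    apply: le_trans (ND _ _) _; rewrite lerD2l NZ gtr0_norm//.
    by rewrite ler_pM2l.
  have : t * (L * N y) <= 1 / 2 * N y by rewrite mulrA ler_wpM2r.
  have : d * (1 / 2) <= d * `|z| by rewrite ler_pM2l.
  lra.
have := ub _ Nz.
have zz : `|z| ^+ 2 <= 9 / 4.
  by apply: le_trans (_ : (3 / 2) ^+ 2 <= _); [rewrite ler_sqr ?nnegrE//; lra|lra].
(* The first-order gain [2 t |w|^2] cannot exceed errors of order [t ^+ 2], because [a] is almost an
   upper bound; hence [w] is small. *)
have -> : rdot (A z) z = a * `|z| ^+ 2 + (rdot (A y) y - a) + 2 * t * `|w| ^+ 2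
    + t ^+ 2 * rdot (A w - a *: w) w.
  rewrite -!rdot_norm /z linearD linearZ !rdotE.
  have Awy : rdot (A w) y = rdot w w + a * rdot w y by rewrite Asym Aye !rdotE.
  rewrite Aye !rdotE Awy (rdotC y w) (rdot_norm y) y1; ring.
have : - L ^+ 3 <= rdot (A w - a *: w) w.
  rewrite lerNl; apply: le_trans (ler_norm _) _; rewrite normrN.
  apply: le_trans (rdot_cauchy _ _) _.
  have : `|A w - a *: w| <= L * L by apply: le_trans (wL _) _; rewrite ler_wpM2l.
  move=> h; apply: le_trans (_ : (L * L) * L <= _); first exact: ler_pM.
  by rewrite !exprS expr0 mulr1 mulrA.
move=> low up.
have {low} : - (t ^+ 2 * L ^+ 3) <= t ^+ 2 * rdot (A w - a *: w) w.
  by rewrite -mulrN ler_pM2l.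
have : (a + t ^+ 2) * `|z| ^+ 2 <= a * `|z| ^+ 2 + t ^+ 2 * (9 / 4).
  by rewrite mulrDl lerD2l ler_pM2l.
move=> h1 h2.
have {h1 h2} : t * (2 * `|w| ^+ 2 - t * (5 + L ^+ 3)) <= 0 by lra.
rewrite pmulr_rle0// => h.
rewrite -ler_sqr ?nnegrE ?(ltW eps0)//.
by have := sqr_ge0 `|w|; lra.
Qed.

End approximate_spectrum.

(** * Bijectivity of coercive operators *)

Section coercive_operators.
Context {R : realType} {H : rightQuaternionicHilbertType R}.
Implicit Types (x y z : H) (a b m L : R).

Lemma coercive_inj (P : {linear H -> H}) m :
  0 < m -> (forall x, m * `|x| ^+ 2 <= rdot (P x) x) -> injective P.
Proof.
move=> m0 coer x y Pxy; apply/eqP; rewrite -subr_eq0 -normr_eq0 -sqrf_eq0.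
have := coer (x - y); rewrite linearB Pxy subrr -(scale0r (0 : H)) rdotZl mul0r.
by rewrite pmulr_rle0// => h; rewrite eq_le h sqr_ge0.
Qed.

(* [x |-> x - c (P x - y)] is a contraction for small positive [c]. *)
Lemma coercive_surj (P : {linear H -> H}) m L :
  0 < m -> bounded_by L P -> (forall x, m * `|x| ^+ 2 <= rdot (P x) x) ->
  forall y, exists x, P x = y.
Proof.
move=> m0 PL coer y; pose M := Num.max L m.
have mM : m <= M by rewrite le_max lexx orbT.
have M0 : 0 < M by exact: lt_le_trans mM.
have PM x : `|P x| <= M * `|x|.
  by apply: le_trans (PL x) _; rewrite ler_wpM2r// le_max lexx.
(* This [c] minimises [1 - 2 c m + c^2 M^2], the bound on the squared contraction factor; [k] is the
   minimum. *)
pose c := m / M ^+ 2; pose k := 1 - m ^+ 2 / M ^+ 2.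
have c0 : 0 < c by rewrite divr_gt0// exprn_gt0.
have k0 : 0 <= k.
  by rewrite subr_ge0 ler_pdivrMr ?exprn_gt0// mul1r ler_sqr// nnegrE ltW.
have k1 : Num.sqrt k < 1.
  by rewrite -sqrtr1 ltr_sqrt// ltrBlDr ltrDl divr_gt0// exprn_gt0.
pose f x := x - c *: (P x - y).
have ff x x' : `|f x - f x'| <= Num.sqrt k * `|x - x'|.
  have -> : f x - f x' = (x - x') + (- c) *: P (x - x').
    rewrite /f (linearB P) scaleNr opprD addrACA -opprD -scalerBr.
    by rewrite opprB addrA subrK.
  move: (x - x') => w.
  rewrite -ler_sqr ?nnegrE ?mulr_ge0 ?sqrtr_ge0// exprMn sqr_sqrtr//.
  rewrite normrD_sqr rdotZr normrZ normrN (gtr0_norm c0) exprMn rdotC.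
  have h1 := coer w.
  have h2 : `|P w| ^+ 2 <= M ^+ 2 * `|w| ^+ 2.
    by rewrite -exprMn ler_sqr ?nnegrE ?mulr_ge0// ltW.
  have h3 : c ^+ 2 * `|P w| ^+ 2 <= c ^+ 2 * (M ^+ 2 * `|w| ^+ 2).
    by rewrite ler_pM2l ?exprn_gt0.
  have h4 : c * (m * `|w| ^+ 2) <= c * rdot (P w) w by rewrite ler_pM2l.
  have e1 : k * `|w| ^+ 2 = `|w| ^+ 2 - 2 * (c * (m * `|w| ^+ 2))
      + c ^+ 2 * (M ^+ 2 * `|w| ^+ 2).
    by rewrite /k /c; field; rewrite gt_eqF.
  lra.
have fT : set_fun [set: H] [set: H] f by [].
pose F : {fun [set: H] >-> [set: H]} := HB.pack f (isFun.Build _ _ _ _ f fT).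
have ctr : is_contraction F.
  exists (NngNum (sqrtr_ge0 k)); split => //= -[x x'] _ /=; exact: ff.
have [|p _ pF] := banach_fixed_point ctr (@closedT _); first by exists 0.
exists p; apply/eqP; rewrite -subr_eq0.
have /eqP : c *: (P p - y) = 0.
  by apply: (addrI (p - c *: (P p - y))); rewrite subrK addr0 {1}pF.
by rewrite scaler_eq0 gt_eqF.
Qed.

End coercive_operators.

(** * Normal operators and their S-spectrum *)

Section normal_pair.
Context {R : realType} {H : rightQuaternionicHilbertType R}.
Implicit Types (x y z : H) (a b d : R) (p q : quaternion R).

Record normal_pair (K : R) (T S : {linear H -> H}) : Prop := NormalPair {
  pair_rscale : forall x q, T (rscale x q) = rscale (T x) q;
  pair_rscale_adj : forall x q, S (rscale x q) = rscale (S x) q;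
  pair_adj : adjoint_of T S;
  pair_comm : forall x, S (T x) = T (S x);
  pair_bound : bounded_by K T;
  pair_bound_adj : bounded_by K S;
  pair_ge0 : 0 <= K }.

Lemma inner_inj_r y z : (forall x, inner x y = inner x z) -> y = z.
Proof.
move=> e; apply/eqP; rewrite -subr_eq0 -normr_eq0 -sqrf_eq0 -rdot_norm.
by rewrite /rdot innerBr e subrr.
Qed.

(** The adjoint is linear because a vector is determined by its inner products, and bounded because
    [|S x|^2 = <T (S x), x>]. *)
Lemma normal_pair_exists (T : H -> H) :
  bounded_operators T -> normal_operator T ->
  exists K (T' S : {linear H -> H}), T = T' :> (H -> H) /\ normal_pair K T' S.
Proof.
move=> [[TD Tq] [K0 TK0]] [S TS ST].
pose K := Num.max 0 K0.
have K_ge0 : 0 <= K by rewrite le_max lexx.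
have TK x : `|T x| <= K * `|x|.
  by apply: le_trans (TK0 x) _; rewrite ler_wpM2r// le_max lexx orbT.
have Tlin : linear T by move=> a x y; rewrite TD -rscale_real Tq rscale_real.
have SD x y : S (x + y) = S x + S y.
  by apply: inner_inj_r => z; rewrite -TS !innerDr !TS.
have Sq x q : S (rscale x q) = rscale (S x) q.
  by apply: inner_inj_r => z; rewrite -TS !innerZr TS.
have Slin : linear S by move=> a x y; rewrite SD -rscale_real Sq rscale_real.
have SK x : `|S x| <= K * `|x|.
  have [->|n0] := eqVneq `|S x| 0; first exact: mulr_ge0.
  rewrite -(@ler_pM2l _ `|S x|) ?lt_neqAle 1?eq_sym ?n0//= -expr2 -rdot_norm.
  rewrite /rdot -TS; apply: le_trans (ler_norm _) _.
  apply: le_trans (rdot_cauchy _ _) _.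
  by rewrite mulrCA mulrA ler_wpM2r.
pose T' : {linear H -> H} := HB.pack T (GRing.isLinear.Build R H H *:%R T Tlin).
pose S' : {linear H -> H} := HB.pack S (GRing.isLinear.Build R H H *:%R S Slin).
exists K, T', S'; split=> //; split => //= x; exact: (congr1 (@^~ x) ST).
Qed.

Section theory.
Context {K : R} {T S : {linear H -> H}} (TS : normal_pair K T S).

Lemma adjointC x y : inner (S x) y = inner x (T y).
Proof. by rewrite inner_conj -(pair_adj TS) -inner_conj. Qed.

Lemma rdot_adj x y : rdot (T x) y = rdot x (S y).
Proof. by rewrite /rdot (pair_adj TS). Qed.

Lemma rdot_adjC x y : rdot (S x) y = rdot x (T y).
Proof. by rewrite /rdot adjointC. Qed.

(** Normality in metric form: the squared norms pair [x] with [T (S x)] and with [S (T x)]. *)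
Lemma norm_adj x : `|S x| = `|T x|.
Proof.
by apply: sqr_inj_ge0 => //; rewrite -!rdot_norm rdot_adj rdot_adjC (pair_comm TS).
Qed.

End theory.
End normal_pair.

(** * Cartesian decomposition of a normal operator *)

Section cartesian_decomposition.
Context {R : realType} {H : rightQuaternionicHilbertType R}.
Implicit Types (x y z : H) (a b d : R) (p q : quaternion R).

Definition iq : quaternion R := Quat 0 1 0 0.
Definition jq : quaternion R := Quat 0 0 1 0.

Fact cartesian_key : unit. Proof. exact: tt. Qed.

(* [T x = op_re x + (op_im x) i]: because of the right multiplication by [i],
   [op_im] is self-adjoint, but only for the real inner product [rdot], and it
   anticommutes with the right multiplication by [j]. Both operators are locked
   to keep rewriting with linearity lemmas from unfolding them. *)
Definition op_re (T S : {linear H -> H}) : {linear H -> H} :=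
  locked_with cartesian_key (2^-1 \*: (T \+ S) : {linear H -> H}).

Definition op_im (T S : {linear H -> H}) : {linear H -> H} :=
  locked_with cartesian_key (rmul iq \o (2^-1 \*: (S \- T)) : {linear H -> H}).

Context {K : R} {T S : {linear H -> H}} (TS : normal_pair K T S).
Local Notation A := (op_re T S).
Local Notation D := (op_im T S).

Lemma op_reE x : A x = 2^-1 *: (T x + S x). Proof. by rewrite /op_re unlock. Qed.

Lemma op_imE x : D x = rscale (2^-1 *: (S x - T x)) iq.
Proof. by rewrite /op_im unlock. Qed.

Lemma op_im_i x : rscale (D x) iq = 2^-1 *: (T x - S x).
Proof.
rewrite op_imE rscaleA (_ : iq * iq = qreal (-1)).
  by rewrite rscale_real scaleN1r -scalerN opprB.
by apply: quatP => /=; ring.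
Qed.

Lemma half_double x : 2^-1 *: (x + x) = x.
Proof.
by rewrite -[in LHS](scale1r x) -scalerDl scalerA mulVf ?scale1r// pnatr_eq0.
Qed.

Lemma op_cartesian x : T x = A x + rscale (D x) iq.
Proof.
rewrite op_im_i op_reE -scalerDr addrACA subrr addr0.
by rewrite half_double.
Qed.

Lemma op_re_rscale x q : A (rscale x q) = rscale (A x) q.
Proof.
by rewrite !op_reE (pair_rscale TS) (pair_rscale_adj TS) -rscaleDl rscaleZl.
Qed.

Lemma op_im_j x : D (rscale x jq) = - rscale (D x) jq.
Proof.
rewrite !op_imE (pair_rscale TS) (pair_rscale_adj TS) -rscaleBl -rscaleZl.
rewrite !rscaleA -rscaleNr; congr rscale.
by apply: quatP => /=; ring.
Qed.

Lemma op_re_bound : bounded_by K A.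
Proof.
move=> x; rewrite op_reE normrZ gtr0_norm ?invr_gt0// mulrC ler_pdivrMr//.
apply: le_trans (ler_normD _ _) _.
by have := pair_bound TS x; have := pair_bound_adj TS x; lra.
Qed.

Lemma norm_iq : `|iq| = 1.
Proof. by apply: sqr_inj_ge0 => //; rewrite sqr_normq /=; ring. Qed.

Lemma norm_jq : `|jq| = 1.
Proof. by apply: sqr_inj_ge0 => //; rewrite sqr_normq /=; ring. Qed.

Lemma op_im_bound : bounded_by K D.
Proof.
move=> x; rewrite op_imE norm_rscale norm_iq mulr1.
rewrite normrZ gtr0_norm ?invr_gt0// mulrC ler_pdivrMr//.
apply: le_trans (ler_normB _ _) _.
by have := pair_bound TS x; have := pair_bound_adj TS x; lra.
Qed.

Lemma op_re_sa : self_adjoint A.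
Proof.
by move=> x y; rewrite !op_reE !rdotE (rdot_adj TS) (rdot_adjC TS) addrC.
Qed.

Lemma rdot_i x y : rdot (rscale x iq) y = - rdot x (rscale y iq).
Proof. by rewrite /rdot innerZl innerZr /=; ring. Qed.

Lemma op_im_sa : self_adjoint D.
Proof.
move=> x y; rewrite !op_imE rdot_i rscaleZl rscaleBl.
rewrite -(pair_rscale TS) -(pair_rscale_adj TS) !rdotE.
by rewrite (rdot_adj TS) (rdot_adjC TS); ring.
Qed.

Lemma op_re_commT x : A (T x) = T (A x).
Proof. by rewrite !op_reE (linearZZ T) (linearD T) (pair_comm TS). Qed.

Lemma op_re_commS x : A (S x) = S (A x).
Proof. by rewrite !op_reE (linearZZ S) (linearD S) (pair_comm TS). Qed.

Lemma op_comm x : A (D x) = D (A x).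
Proof.
rewrite !op_imE op_re_rscale; congr rscale.
by rewrite (linearZZ A) (linearB A) op_re_commT op_re_commS.
Qed.

Lemma rdot_op_re x : rdot (A x) x = qre (inner (T x) x).
Proof. by rewrite op_reE !rdotE (rdot_adjC TS) (rdotC x) /rdot; field. Qed.

Lemma rdot_op_im x : rdot (D x) x = qi (inner (T x) x).
Proof.
rewrite op_imE /rdot innerZl innerZ innerBl (adjointC TS) [inner x _]inner_conj /=.
by field.
Qed.

End cartesian_decomposition.

(** * S-spectrum and approximate eigenvalues *)

Section S_spectrum_theory.
Context {R : realType} {H : rightQuaternionicHilbertType R}.
Implicit Types (x y z : H) (a b d : R) (p q : quaternion R).

Definition approximate_eigenvalue_of (T : H -> H) p : Prop :=
  forall d, 0 < d -> exists2 x, `|x| = 1 & `|T x - rscale x p| <= d.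

Fact Delta_linear q (T : {linear H -> H}) : linear (Delta q T).
Proof.
move=> a x y; rewrite /Delta !(linearD T) !(linearZZ T).
have c3 (u1 u2 v1 v2 w1 w2 : H) : (u1 + u2) - (v1 + v2) + (w1 + w2) =
    (u1 - v1 + w1) + (u2 - v2 + w2).
  by rewrite opprD -[RHS]addrACA; congr (_ + _); rewrite addrACA.
rewrite !scalerDr c3 !scalerN !scalerA (mulrC a (2 * _)) (mulrC a (_ ^+ 2)).
by [].
Qed.

HB.instance Definition _ q T :=
  GRing.isLinear.Build R H H *:%R (Delta q (T : {linear H -> H})) (Delta_linear q T).

Context {K : R} {T S : {linear H -> H}} (TS : normal_pair K T S).

Lemma Delta_factor p x :
  Delta p T x = T (T x - rscale x p) - rscale (T x - rscale x p) (quat_conj p).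
Proof.
rewrite (linearB T) (pair_rscale TS) rscaleBl rscaleA mulq_conj rscale_real.
rewrite opprD opprK addrA -(addrA (T (T x))) -opprD -rscaleDr.
rewrite (_ : p + quat_conj p = qreal (2 * qre p)) ?rscale_real//.
by apply: quatP => /=; ring.
Qed.

(** By [Delta_factor], [Delta p T] is small on approximate eigenvectors, which excludes a bounded
    inverse. *)
Lemma approximate_eigenvalue_S_spectrum p :
  approximate_eigenvalue_of T p -> S_spectrum T p.
Proof.
move=> ap [U [[UD Uq] [M UM]] [UDelta _]].
have M0 : 0 <= M.
  have [x x1 _] := ap _ ltr01.
  by have := UM x; rewrite x1 mulr1; apply: le_trans.
have K0 := pair_ge0 TS; pose L := M * (K + `|p|).
have L0 : 0 <= L by rewrite mulr_ge0// addr_ge0.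
have d0 : 0 < (L + 1)^-1 by rewrite invr_gt0; lra.
have [x x1 xd] := ap _ d0; set w := T x - rscale x p in xd.
suff : 1 <= L * (L + 1)^-1.
  rewrite ler_pdivlMr; lra.
rewrite -[leLHS]x1 -{1}[x](congr1 (@^~ x) UDelta) /=.
apply: le_trans (UM _) _; rewrite -mulrA ler_wpM2l// Delta_factor -/w.
apply: le_trans (ler_normB _ _) _; rewrite norm_rscale normq_conj mulrDl.
apply: lerD; first by apply: le_trans (pair_bound TS _) _; rewrite ler_wpM2l.
by rewrite mulrC ler_wpM2l.
Qed.

Lemma Delta_rscale p x q : Delta p T (rscale x q) = rscale (Delta p T x) q.
Proof.
by rewrite /Delta !(pair_rscale TS) rscaleDl rscaleBl !rscaleZl.
Qed.

Lemma Delta_bound p (U : {linear H -> H}) : bounded_by K U ->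
  bounded_by (K ^+ 2 + `|2 * qre p| * K + `|p| ^+ 2) (Delta p U).
Proof.
move=> UK x; have K0 := pair_ge0 TS; rewrite /Delta.
apply: le_trans (ler_normD _ _) _; rewrite normrZ normrX normr_id [leRHS]mulrDl.
rewrite lerD2r; apply: le_trans (ler_normB _ _) _; rewrite normrZ [leRHS]mulrDl.
apply: lerD; last by rewrite -mulrA ler_wpM2l.
by rewrite expr2 -mulrA; apply: le_trans (UK _) _; rewrite ler_wpM2l.
Qed.

Lemma Delta_adj p x y : inner (Delta p T x) y = inner x (Delta p S y).
Proof.
rewrite /Delta innerDl innerBl innerDr innerBr !innerZ !inner_scaler.
by rewrite !(pair_adj TS).
Qed.

Lemma Delta_comm p x : Delta p S (Delta p T x) = Delta p T (Delta p S x).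
Proof.
have comm2 y : S (T (T y)) = T (T (S y)) by rewrite !(pair_comm TS).
have commD y : S (Delta p T y) = Delta p T (S y).
  by rewrite /Delta (linearD S) (linearB S) !(linearZZ S) comm2 (pair_comm TS).
rewrite [LHS]/Delta !commD (linearD (Delta p T)) (linearB (Delta p T)).
by rewrite !(linearZZ (Delta p T)).
Qed.

(** The product [P] of [Delta p T] with its adjoint [Delta p S] is coercive, hence bijective. By
    normality the factors commute, so [P^-1 Delta p S] is a two-sided inverse. *)
Lemma Delta_invertible p m : 0 < m ->
  (forall x, m * `|x| <= `|Delta p T x|) -> invertible_operator (Delta p T).
Proof.
move=> m0 mD.
pose P : {linear H -> H} := Delta p S \o Delta p T.
have m2 : 0 < m ^+ 2 by rewrite exprn_gt0.
have coer x : m ^+ 2 * `|x| ^+ 2 <= rdot (P x) x.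
  rewrite rdotC /rdot -Delta_adj -/(rdot _ _) rdot_norm -exprMn.
  by rewrite ler_sqr ?nnegrE// mulr_ge0// ltW.
set L := K ^+ 2 + `|2 * qre p| * K + `|p| ^+ 2.
have K0 := pair_ge0 TS.
have L0 : 0 <= L by rewrite !addr_ge0 ?mulr_ge0 ?sqr_ge0.
have SL : bounded_by L (Delta p S) := Delta_bound p (pair_bound_adj TS).
have TL : bounded_by L (Delta p T) := Delta_bound p (pair_bound TS).
have PL : bounded_by (L * L) P.
  by move=> x; apply: le_trans (SL _) _; rewrite -mulrA ler_wpM2l//; exact: TL.
have Pinj := coercive_inj m2 coer.
have [g gP] := choice (coercive_surj m2 PL coer).
have Sq x q : Delta p S (rscale x q) = rscale (Delta p S x) q.
  by rewrite /Delta !(pair_rscale_adj TS) rscaleDl rscaleBl !rscaleZl.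
have Pq x q : P (rscale x q) = rscale (P x) q.
  by rewrite /P /= Delta_rscale Sq.
exists (g \o Delta p S).
  split; [split => [x y|x q] /=|].
  - by apply: Pinj; rewrite (linearD P) !gP linearD.
  - by apply: Pinj; rewrite Pq !gP Sq.
  - exists (m ^- 2 * L) => x /=.
    rewrite -mulrA ler_pdivlMl//; apply: le_trans (SL x).
    set y := g _; have yx : P y = Delta p S x by rewrite /y gP.
    have [->|y0] := eqVneq `|y| 0; first by rewrite mulr0.
    rewrite -(@ler_pM2r _ `|y|) ?lt_neqAle 1?eq_sym ?y0//=.
    rewrite -mulrA -expr2; apply: le_trans (coer y) _.
    by apply: le_trans (ler_norm _) _; rewrite -yx; exact: rdot_cauchy.
split; apply/funext => x /=; first by apply: Pinj; rewrite gP.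
have comm y : P (Delta p T y) = Delta p T (P y) by rewrite /P /= Delta_comm.
by apply: Pinj; rewrite comm gP /P /= Delta_comm.
Qed.

(** If [x |-> T x - x p] is bounded below by [d], so is the same map for [p^*], since right
    multiplication by [j] exchanges [p] and [p^*]. Then [Delta p T] is bounded below by [d ^+ 2]. *)
Lemma S_spectrum_approximate_eigenvalue a b :
  S_spectrum T (cplx a b) -> approximate_eigenvalue_of T (cplx a b).
Proof.
set p := cplx a b => specp; apply: contrapT => /existsNP[d] /not_implyP[d0 nox].
apply: specp; have E x : d * `|x| <= `|T x - rscale x p|.
  have [->|x0] := eqVneq x 0; first by rewrite normr0 mulr0.
  have n0 : 0 < `|x| by rewrite normr_gt0.
  rewrite leNgt; apply/negP => lt; apply: nox; exists (`|x|^-1 *: x).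
    by rewrite normrZ normfV normr_id mulVf ?gt_eqF.
  rewrite (linearZZ T) rscaleZl -scalerBr normrZ normfV normr_id.
  by rewrite ler_pdivrMl// mulrC ltW.
have E' x : d * `|x| <= `|T x - rscale x (quat_conj p)|.
  have := E (rscale x jq); rewrite (pair_rscale TS) rscaleA.
  rewrite (_ : jq * p = quat_conj p * jq); last by apply: quatP => /=; ring.
  by rewrite -rscaleA -rscaleBl !norm_rscale norm_jq !mulr1.
apply: (@Delta_invertible _ (d ^+ 2)) => [|x]; first by rewrite exprn_gt0.
rewrite Delta_factor; apply: le_trans (E' _).
by rewrite expr2 -mulrA ler_pM2l.
Qed.

End S_spectrum_theory.

(** * Joint approximate spectrum of the two cartesian parts *)

Section joint_spectrum.
Context {R : realType} {H : rightQuaternionicHilbertType R}.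
Implicit Types (x y z : H) (a b c d : R) (p q : quaternion R).
Context {K : R} {T S : {linear H -> H}} (TS : normal_pair K T S).
Local Notation A := (op_re T S).
Local Notation D := (op_im T S).

Definition op_comb a b : {linear H -> H} :=
  locked_with cartesian_key ((a \*: A) \+ (b \*: D) : {linear H -> H}).

Lemma op_combE a b x : op_comb a b x = a *: A x + b *: D x.
Proof. by rewrite /op_comb unlock. Qed.

Lemma op_comb_sa a b : self_adjoint (op_comb a b).
Proof.
by move=> x y; rewrite !op_combE !rdotE (op_re_sa TS) (op_im_sa TS).
Qed.

Lemma op_comb_bound a b : bounded_by ((`|a| + `|b|) * K) (op_comb a b).
Proof.
move=> x; rewrite op_combE; apply: le_trans (ler_normD _ _) _.
rewrite !normrZ -mulrA mulrDl; apply: lerD; rewrite ler_wpM2l//.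
  exact: (op_re_bound TS).
exact: (op_im_bound TS).
Qed.

Lemma op_comb_commA a b x : op_comb a b (A x) = A (op_comb a b x).
Proof. by rewrite !op_combE (linearD A) !(linearZZ A) (op_comm TS). Qed.

Lemma op_comb_commD a b x : op_comb a b (D x) = D (op_comb a b x).
Proof. by rewrite !op_combE (linearD D) !(linearZZ D) (op_comm TS). Qed.

Lemma approximate_joint_eigenvalue a b :
  (forall d, 0 < d -> exists x,
    [/\ `|x| = 1, `|A x - a *: x| <= d & `|D x - b *: x| <= d]) ->
  approximate_eigenvalue_of T (cplx a b).
Proof.
move=> ap d d0; have [|x [x1 xa xb]] := ap (d / 2); first by lra.
exists x => //.
have -> : T x - rscale x (cplx a b) = (A x - a *: x) + rscale (D x - b *: x) iq.
  rewrite {1}(@op_cartesian _ _ T S) rscaleBl rscaleZl.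
  rewrite (_ : cplx a b = qreal a + b *: iq); last by apply: quatP => /=; ring.
  by rewrite rscaleDr rscale_real rscaleZr opprD addrACA.
apply: le_trans (ler_normD _ _) _.
by rewrite norm_rscale norm_iq mulr1; lra.
Qed.

(** Right multiplication by [j] commutes with [A] and anticommutes with [D], so it turns [(a, b)]
    into [(a, - b)]. *)
Lemma joint_eigenvalue_upper_S_spectrum a b :
  (forall d, 0 < d -> exists x,
    [/\ `|x| = 1, `|A x - a *: x| <= d & `|D x - b *: x| <= d]) ->
  upper_S_spectrum T (cplx a `|b|).
Proof.
move=> ap; split; last by split => //=.
apply: (approximate_eigenvalue_S_spectrum TS).
have [b0|b0] := leP 0 b.
  by rewrite ger0_norm//; exact: approximate_joint_eigenvalue.
rewrite ltr0_norm//; apply: approximate_joint_eigenvalue => d /ap [x [x1 xa xb]].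
exists (rscale x jq); split; first by rewrite norm_rscale norm_jq mulr1.
  by rewrite (op_re_rscale TS) -rscaleZl -rscaleBl norm_rscale norm_jq mulr1.
rewrite (op_im_j TS) -rscaleZl -rscaleNl -rscaleBl norm_rscale norm_jq mulr1.
by rewrite scaleNr opprK addrC -normrN opprD opprK addrC.
Qed.

(** [approximate_eigenvalue] is applied to [D], keeping [op_comb al be x - mu x] small, and then to
    [A], keeping the defect of [D] small too. Commutation makes both smallness conditions stable,
    and the linear relation survives in the limit. *)
Lemma joint_spectrum_above al be mu c :
  (forall d, 0 < d -> exists x, [/\ `|x| = 1,
     `|op_comb al be x - mu *: x| <= d & c - d <= rdot (D x) x]) ->
  exists a b, [/\ c <= b, al * a + be * b = mu &
    upper_S_spectrum T (cplx a `|b|)].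
Proof.
move=> ap; have K0 := pair_ge0 TS.
pose N1 x := `|op_comb al be x - mu *: x|.
have N1D x y : N1 (x + y) <= N1 x + N1 y.
  rewrite /N1 (linearD (op_comb al be)) scalerDr opprD addrACA.
  exact: ler_normD.
have N1Z e x : N1 (e *: x) = `|e| * N1 x.
  by rewrite /N1 (linearZZ (op_comb al be)) scalerA mulrC -scalerA -scalerBr normrZ.
have N1DD x : N1 (D x) <= K * N1 x.
  rewrite /N1 op_comb_commD -(linearZZ D) -(linearB D).
  exact: (op_im_bound TS).
have N1A x : N1 (A x) <= K * N1 x.
  rewrite /N1 op_comb_commA -(linearZZ A) -(linearB A).
  exact: (op_re_bound TS).
have [b cb apb] := approximate_eigenvalue (op_im_bound TS) (op_im_sa TS) N1D N1Z N1DD ap.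
pose N2 x := N1 x + `|D x - b *: x|.
have N2D x y : N2 (x + y) <= N2 x + N2 y.
  rewrite /N2 addrACA lerD// (linearD D) scalerDr opprD addrACA.
  exact: ler_normD.
have N2Z e x : N2 (e *: x) = `|e| * N2 x.
  by rewrite /N2 N1Z (linearZZ D) scalerA (mulrC b) -scalerA -scalerBr normrZ mulrDr.
have N2A x : N2 (A x) <= K * N2 x.
  rewrite /N2 mulrDr lerD// -(op_comm TS) -(linearZZ A) -(linearB A).
  exact: (op_re_bound TS).
(* The bound [- K] holds for every unit vector: any approximate eigenvalue of [A] will do. *)
have ap2 d : 0 < d -> exists x, [/\ `|x| = 1, N2 x <= d & - K - d <= rdot (A x) x].
  move=> d0; have [|x [x1 xN xb]] := apb (d / 2); first by lra.
  exists x; split => //; first by rewrite /N2; lra.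
  suff : `|rdot (A x) x| <= K by rewrite ler_norml => /andP[]; lra.
  apply: le_trans (rdot_cauchy _ _) _.
  by have := op_re_bound TS x; rewrite x1 !mulr1.
have [a _ apa] := approximate_eigenvalue (op_re_bound TS) (op_re_sa TS) N2D N2Z N2A ap2.
exists a, b; split => //.
  apply/eqP; rewrite -subr_eq0; apply/eqP.
  apply: (@le_small_eq0 _ _ (1 + `|al| + `|be|)) => d d0.
  have [x [x1 xN xa]] := apa _ d0.
  have xN1 : N1 x <= d.
    by apply: le_trans xN; rewrite lerDl.
  have xb : `|D x - b *: x| <= d.
    by apply: le_trans xN; rewrite lerDr normr_ge0.
  have -> : `|al * a + be * b - mu| = `|(op_comb al be x - mu *: x)
      - (al *: (A x - a *: x) + be *: (D x - b *: x))|.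
    rewrite -[LHS]mulr1 -x1 -normrZ; congr `|_|.
    have reassoc (u v u' v' w : H) :
        u + v - w - ((u - u') + (v - v')) = u' + v' - w.
      rewrite addrACA -opprD; apply/eqP.
      by rewrite subr_eq [eqbRHS]addrC addrA subrK.
    by rewrite op_combE !scalerBr reassoc scalerBl scalerDl !scalerA.
  apply: le_trans (ler_normB _ _) _.
  rewrite -addrA mulrDl mul1r; apply: lerD => //.
  apply: le_trans (ler_normD _ _) _; rewrite !normrZ mulrDl.
  by apply: lerD; rewrite ler_wpM2l.
apply: joint_eigenvalue_upper_S_spectrum => d d0.
have [x [x1 xN xa]] := apa _ d0; exists x; split => //.
by apply: le_trans xN; rewrite lerDr normr_ge0.
Qed.

(** With [N = 0], maximising the form of [op_comb al be] over the unit sphere gives an approximate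
    eigenvalue [mu >= c], which is then refined to a joint one. *)
Lemma numerical_range_top al be c :
  (exists2 x, `|x| = 1 & c <= rdot (op_comb al be x) x) ->
  exists a b, c <= al * a + be * b /\ upper_S_spectrum T (cplx a `|b|).
Proof.
move=> [x x1 cx]; have K0 := pair_ge0 TS; set L := (`|al| + `|be|) * K.
have [| | | |mu cmu apmu] := @approximate_eigenvalue _ _ (op_comb al be) L c
  (fun=> 0) (@op_comb_bound al be) (@op_comb_sa al be).
- by move=> *; rewrite addr0.
- by move=> *; rewrite mulr0.
- by move=> *; rewrite mulr0.
- by move=> d d0; exists x; split => //; [exact: ltW|lra].
have [|a [b [_ ab spec]]] := @joint_spectrum_above al be mu (- K).
  move=> d d0; have [y [y1 _ ymu]] := apmu _ d0; exists y; split => //.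
  suff : `|rdot (D y) y| <= K by rewrite ler_norml => /andP[]; lra.
  apply: le_trans (rdot_cauchy _ _) _.
  by have := op_im_bound TS y; rewrite y1 !mulr1.
by exists a, b; rewrite ab.
Qed.

(** The norm of [D x] serves as the small quantity. The coefficient [be] is arbitrary because
    [be * D x] is negligible on such vectors. *)
Lemma null_op_im_top al be c :
  (forall d, 0 < d -> exists x,
    [/\ `|x| = 1, `|D x| <= d & c - d <= al * rdot (A x) x]) ->
  exists a b, [/\ 0 <= b, c <= al * a + be * b & upper_S_spectrum T (cplx a b)].
Proof.
move=> ap; have K0 := pair_ge0 TS.
have combA x : op_comb al 0 x = al *: A x by rewrite op_combE scale0r addr0.
have [| | | |mu cmu apmu] := @approximate_eigenvalue _ _ (op_comb al 0)
  ((`|al| + `|0|) * K) c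
  (fun x => `|D x|) (@op_comb_bound al 0) (@op_comb_sa al 0).
- by move=> x y; rewrite (linearD D) ler_normD.
- by move=> e x; rewrite (linearZZ D) normrZ.
- by move=> x; rewrite -op_comb_commD; exact: op_comb_bound.
- by move=> d /ap [x [x1 Dx cx]]; exists x; split; rewrite // combA rdotZl.
have [|a [b [b0 ab spec]]] := @joint_spectrum_above al be mu 0.
  move=> d d0; pose e := d / (1 + `|be|).
  have be1 : 0 < 1 + `|be| by rewrite ltr_pwDl.
  have e0 : 0 < e by rewrite divr_gt0.
  have ed : e * (1 + `|be|) = d by rewrite /e divfK// gt_eqF.
  have eb : 0 <= e * `|be| by rewrite mulr_ge0// ltW.
  have [x [x1 Dx mux]] := apmu _ e0; exists x; split => //.
    have -> : op_comb al be x - mu *: x = (op_comb al 0 x - mu *: x) + be *: D x.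
      by rewrite combA op_combE addrAC.
    apply: le_trans (ler_normD _ _) _; rewrite normrZ -ed mulrDr mulr1.
    by apply: lerD => //; rewrite mulrC ler_wpM2r.
  rewrite sub0r; suff : `|rdot (D x) x| <= d by rewrite ler_norml => /andP[].
  by apply: le_trans (rdot_cauchy _ _) _; rewrite x1 mulr1; lra.
by exists a, b; rewrite ab; rewrite ger0_norm in spec.
Qed.

(** Multiplying [x] on the right by a unit quaternion conjugates its value, so the imaginary part
    can be rotated onto the nonnegative [i] axis. *)
Lemma upper_bild_fold x : `|x| = 1 ->
  upper_bild T (cplx (qre (inner (T x) x)) (imn (inner (T x) x))).
Proof.
move=> x1; have [u u1 uq] := rotate_to_cplx (inner (T x) x).
split; last by split; [split|exact: imn_ge0].
exists (rscale x u); first by rewrite /= norm_rscale x1 u1 mulr1.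
by rewrite (pair_rscale TS) innerZl innerZr -uq.
Qed.

End joint_spectrum.

(** * Real elements of the numerical range *)

Section real_values.
Context {R : realType} {H : rightQuaternionicHilbertType R}.
Implicit Types (x y z w : H) (a b c d r : R) (p q v : quaternion R).

(** The skew-adjoint part of [T], right linear over the quaternions unlike [op_im]. Its form is the
    imaginary part of the value, so its isotropic unit vectors are those with a real value. *)
Definition op_skew (T S : {linear H -> H}) : {linear H -> H} :=
  locked_with cartesian_key (2^-1 \*: (T \- S) : {linear H -> H}).

Context {K : R} {T S : {linear H -> H}} (TS : normal_pair K T S).
Local Notation A := (op_re T S).
Local Notation D := (op_im T S).
Local Notation B := (op_skew T S).

Lemma op_skewE x : B x = 2^-1 *: (T x - S x).
Proof. by rewrite /op_skew unlock. Qed.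

Lemma op_skew_im x : B x = rscale (D x) iq.
Proof. by rewrite op_skewE op_im_i. Qed.

Lemma norm_op_skew x : `|B x| = `|D x|.
Proof. by rewrite op_skew_im norm_rscale norm_iq mulr1. Qed.

Lemma op_skew_rscale x q : B (rscale x q) = rscale (B x) q.
Proof.
by rewrite !op_skewE (pair_rscale TS) (pair_rscale_adj TS) -rscaleBl rscaleZl.
Qed.

Lemma inner_op_skew x y : inner (B x) y = - inner x (B y).
Proof.
rewrite !op_skewE innerZ inner_scaler innerBl innerBr (pair_adj TS) (adjointC TS).
by rewrite -scalerN opprB.
Qed.

Lemma inner_op_skewC x y : inner (B x) y = - quat_conj (inner (B y) x).
Proof. by rewrite inner_op_skew inner_conj. Qed.

Lemma inner_cartesian x : inner (T x) x = qreal (rdot (A x) x) + inner (B x) x.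
Proof.
rewrite {1}(@op_cartesian _ _ T S) -op_skew_im innerDl; congr (_ + _).
rewrite op_reE /rdot !innerZ innerDl (adjointC TS) [inner x _]inner_conj.
by apply: quatP => /=; ring.
Qed.

Lemma quat_im_inner x : quat_im (inner (T x) x) = inner (B x) x.
Proof.
have e := inner_op_skewC x x; have := congr1 (@qre R) e => /= re0.
rewrite inner_cartesian; apply: quatP => /=; rewrite ?add0r//.
by apply/eqP; rewrite eq_le; apply/andP; split; lra.
Qed.

Lemma real_bild_isotropic z : z != 0 -> inner (B z) z = 0 ->
  real_bild T (rdot (A z) z / `|z| ^+ 2).
Proof.
move=> z0 iso; have n0 : `|z| != 0 by rewrite normr_eq0.
split; last by split.
exists (`|z|^-1 *: z); first by rewrite /= normrZ normfV normr_id mulVf.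
rewrite (linearZZ T) innerZ inner_scaler inner_cartesian iso addr0.
by apply: quatP => /=; rewrite ?mulr0//; field.
Qed.

Lemma real_bildP r : real_bild T r ->
  exists x, [/\ `|x| = 1, inner (B x) x = 0 & rdot (A x) x = r].
Proof.
move=> [[x /= x1 xr] _]; exists x; split => //.
  by rewrite -quat_im_inner xr.
by rewrite (rdot_op_re TS) xr.
Qed.

Lemma real_bild_bound r : real_bild T r -> `|r| <= K.
Proof.
move=> /real_bildP [x [x1 _ <-]]; apply: le_trans (rdot_cauchy _ _) _.
by have := op_re_bound TS x; rewrite x1 !mulr1.
Qed.

Lemma inner_op_skewD x y p : inner (B (x + rscale y p)) (x + rscale y p) =
  inner (B x) x + (inner (B y) x * p - quat_conj (inner (B y) x * p))
  + quat_conj p * inner (B y) y * p.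
Proof.
rewrite linearD op_skew_rscale innerDl !innerDr !innerZr !innerZl.
rewrite (inner_op_skewC x y) quat_conjM mulrN -!addrA; congr (_ + _).
by rewrite mulrA addrCA !addrA.
Qed.

(** After a rotation of [y2] making its cross term with [y1] real, the whole real span of the two
    vectors is isotropic. On [y1 + t y] the value [r] is reached at a root of a quadratic whose
    discriminant is positive. *)
Lemma real_bild_interval r1 r2 r :
  real_bild T r1 -> real_bild T r2 -> r1 < r -> r < r2 -> real_bild T r.
Proof.
move=> /real_bildP [y1 [n1 iso1 v1]] /real_bildP [y2 [n2 iso2 v2]] r1r rr2.
have [u u1 nu] : exists2 u, `|u| = 1 &
    inner (B y2) y1 * u = quat_conj (inner (B y2) y1 * u).
  set n := inner _ _; have [->|nn0] := eqVneq n 0.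
    exists 1; first by apply: sqr_inj_ge0 => //; rewrite sqr_normq /=; ring.
    by apply: quatP => /=; ring.
  have [p np pn] := quat_right_inv nn0.
  have p0 : `|p| != 0 by rewrite pn invr_eq0 normr_eq0.
  exists (`|p|^-1 *: p); first by rewrite normrZ normfV normr_id mulVf.
  by rewrite scaleqAr np; apply: quatP => /=; ring.
pose y := rscale y2 u.
have vy : rdot (A y) y = r2.
  have := inner_cartesian y2; rewrite iso2 addr0 v2 => Ty2.
  rewrite (rdot_op_re TS) (pair_rscale TS) innerZl innerZr Ty2 mulqr scaleqAl.
  have : `|u| ^+ 2 = 1 by rewrite u1 expr1n.
  by rewrite sqr_normq /= => s; rewrite -[RHS]mulr1 -s; ring.
have ny : `|y| = 1 by rewrite norm_rscale n2 u1 mulr1.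
pose kap := rdot (A y1) y - r * rdot y1 y.
pose t := (- kap + Num.sqrt (kap ^+ 2 + (r - r1) * (r2 - r))) / (r2 - r).
have t_root : (r1 - r) + 2 * t * kap + t ^+ 2 * (r2 - r) = 0.
  have d0 : r2 - r != 0 by rewrite subr_eq0 gt_eqF.
  have sq : 0 <= kap ^+ 2 + (r - r1) * (r2 - r).
    by rewrite addr_ge0 ?sqr_ge0// mulr_ge0// subr_ge0 ltW.
  have := sqr_sqrtr sq; rewrite /t; set s := Num.sqrt _ => ss.
  by field: ss.
pose z := y1 + t *: y.
have isoz : inner (B z) z = 0.
  have -> : z = y1 + rscale y2 (t *: u) by rewrite rscaleZr.
  rewrite inner_op_skewD iso1 iso2 mulr0 mul0r addr0 add0r scaleqAr.
  move: nu; move: (_ * u) => m nu.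
  have -> : quat_conj (t *: m) = t *: m by rewrite [in RHS]nu; apply: quatP => /=; ring.
  by rewrite subrr.
have valz : rdot (A z) z = r * `|z| ^+ 2.
  rewrite -rdot_norm /z (linearD A) (linearZZ A) !rdotE v1 vy.
  rewrite (op_re_sa TS y y1) (rdotC y (A y1)) (rdotC y y1) !rdot_norm n1 ny.
  by move: t_root; rewrite /kap; lra.
have z0 : z != 0.
  apply/eqP => z0; have y1E : y1 = - (t *: y).
    by apply/eqP; rewrite -addr_eq0 -/z z0.
  have tt : t ^+ 2 = 1.
    by have := n1; rewrite y1E normrN normrZ ny mulr1  => t1;
    rewrite -(real_normK (num_real t)) t1 expr1n.
  have : r1 = r2.
    by rewrite -v1 y1E linearN (linearZZ A) !rdotE vy mulrN opprK mulrA -expr2 tt mul1r.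
  lra.
rewrite (_ : r = rdot (A z) z / `|z| ^+ 2); first exact: real_bild_isotropic.
by rewrite valz mulfK// expf_eq0/= normr_eq0.
Qed.

End real_values.

Section real_values_existence.
Context {R : realType} {H : rightQuaternionicHilbertType R}.
Implicit Types (x y z w : H) (a b c d r : R) (p q v : quaternion R).
Context {K : R} {T S : {linear H -> H}} (TS : normal_pair K T S).
Local Notation A := (op_re T S).
Local Notation D := (op_im T S).
Local Notation B := (op_skew T S).

Lemma rotate_op_skew x : exists2 u, `|u| = 1 &
  quat_conj u * inner (B x) x * u = cplx 0 (imn (inner (B x) x)).
Proof.
have [u u1 uE] := rotate_to_cplx (inner (B x) x); exists u => //.
by rewrite uE; have := quat_im_inner TS x => /(congr1 (@qre R)) /= <-.
Qed.

(* [y2] is a combination of [e 1] and [e 2] for which the compression of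
   [op_skew] to the span of [e 0] and [y2] is diagonal; its two diagonal
   entries can then be rotated to opposite multiples of [i]. *)
Lemma real_bild_nonempty (e : nat -> H) :
  (forall m n, inner (e m) (e n) = (m == n)%:R) -> real_bild T !=set0.
Proof.
move=> eON.
have [z z0 isoz] : exists2 z : H, z != 0 & inner (B z) z = 0; last first.
  by exists (rdot (A z) z / `|z| ^+ 2); exact: (real_bild_isotropic TS).
have [y2 [y20 y2e By2]] : exists y2,
    [/\ y2 != 0, inner y2 (e 0%N) = 0 & inner (B y2) (e 0%N) = 0].
  have [m1|m1] := eqVneq (inner (B (e 1%N)) (e 0%N)) 0.
    exists (e 1%N); split; [|by rewrite eON|by []].
    apply/eqP => e1; have := eON 1%N 1%N; rewrite e1 eqxx inner0l.
    by move=> /eqP; rewrite eq_sym oner_eq0.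
  have [m m1m _] := quat_right_inv m1.
  set m2 := inner (B (e 2%N)) (e 0%N).
  exists (e 2%N - rscale (e 1%N) (m * m2)); split.
  - apply/eqP => y0; have : inner (e 2%N - rscale (e 1%N) (m * m2)) (e 2%N) = 0.
      by rewrite y0 inner0l.
    by rewrite innerBl innerZl !eON /= mul0r subr0 => /eqP; rewrite oner_eq0.
  - by rewrite innerBl innerZl !eON /= mul0r subr0.
  - by rewrite linearB (op_skew_rscale TS) innerBl innerZl mulrA m1m mul1r subrr.
set y1 := e 0%N.
have By1 : inner (B y1) y2 = 0.
  by rewrite (inner_op_skewC TS) By2; apply: quatP => /=; ring.
have [u1 n1 rot1] := rotate_op_skew y1.
have [u2 n2 rot2] := rotate_op_skew y2.
set b1 := imn _ in rot1; set b2 := imn _ in rot2.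
have [b20|b20] := eqVneq b2 0.
  exists y2 => //; have /eqP : imn (inner (B y2) y2) ^+ 2 = 0.
    by rewrite -/b2 b20 expr0n.
  rewrite sqrf_eq0 normr_eq0 => /eqP <-.
  by rewrite -(quat_im_inner TS); apply: quatP.
(* The contributions are [b2 b1 i] and, after conjugation by [j], [- b1 b2 i]: they cancel. *)
pose z := rscale y1 (Num.sqrt b2 *: u1) + rscale y2 (Num.sqrt b1 *: (u2 * jq)).
have zy1 : inner z y1 = Num.sqrt b2 *: u1.
  by rewrite innerDl !innerZl y2e eON eqxx mul1r mul0r addr0.
exists z.
  apply/eqP => z0; move: zy1; rewrite z0 inner0l.
  move/(congr1 Num.norm); rewrite normr0 normrZ n1 mulr1 => /esym/eqP.
  by rewrite normr_eq0 sqrtr_eq0 leNgt lt_neqAle eq_sym b20 imn_ge0.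
rewrite linearD !(op_skew_rscale TS) innerDl !innerDr !innerZl !innerZr By1 By2.
rewrite !(mulr0, mul0r) addr0 add0r.
have s1 : Num.sqrt b1 ^+ 2 = b1 by rewrite sqr_sqrtr// imn_ge0.
have s2 : Num.sqrt b2 ^+ 2 = b2 by rewrite sqr_sqrtr// imn_ge0.
rewrite !quat_conjZ !scaleqAr !scaleqAl !scalerA -!expr2 s1 s2 rot1 quat_conjM.
rewrite mulrA -[quat_conj jq * _ * _]mulrA -(mulrA (quat_conj jq)) rot2.
by apply: quatP => /=; ring.
Qed.

(* With [w = B x] and [k = |w|^2], the vector [x + w v] with [v] imaginary is
   isotropic iff [2 k v = e + v^* rho v], where [e] and [rho] are the imaginary
   quaternions [inner (B x) x] and [inner (B w) w]: a fixed-point equation which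
   is contracting on small balls. It is solved in [H], with [rscale x v] as
   unknown. *)
Lemma near_isotropic c eta : 0 < c -> 0 < eta ->
  exists2 eps, 0 < eps & forall x, `|x| = 1 -> c <= `|B x| ->
    `|inner (B x) x| <= eps -> exists2 z, `|z - x| <= eta & inner (B z) z = 0.
Proof.
move=> c0 eta0; have K0 := pair_ge0 TS.
have BK y : `|B y| <= K * `|y| by rewrite norm_op_skew; exact: (op_im_bound TS).
(* [rad * K <= 1 / 2] makes [F] a contraction of the ball; [rad * K <= eta] bounds the displacement
   [w v]. *)
pose rad := Num.min (1 / 2) eta / (K + 1).
have K1 : 0 < K + 1 by rewrite ltr_wpDl.
have rad0 : 0 < rad by rewrite divr_gt0// lt_min eta0 andbT divr_gt0.
have radK : rad * (K + 1) = Num.min (1 / 2) eta by rewrite /rad divfK// gt_eqF.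
have rK2 : rad * K <= 1 / 2.
  have : rad * (K + 1) <= 1 / 2 by rewrite radK ge_min lexx.
  lra.
have rKeta : rad * K <= eta.
  have : rad * (K + 1) <= eta by rewrite radK ge_min lexx orbT.
  lra.
exists (c ^+ 2 * rad); first by rewrite mulr_gt0// exprn_gt0.
move=> x x1 cBx; set w := B x; set e := inner w x => e_eps.
pose k := `|w| ^+ 2; pose rho := inner (B w) w.
have w0 : 0 < `|w| by apply: lt_le_trans cBx.
have k0 : 0 < k by rewrite exprn_gt0.
have ck : c ^+ 2 <= k by rewrite ler_sqr ?nnegrE// ltW.
have rhoK : `|rho| <= K * k.
  by apply: le_trans (inner_cauchy _ _) _; rewrite /k expr2 mulrA ler_wpM2r.
have ek : `|e| <= k * rad by apply: le_trans e_eps _; rewrite ler_wpM2r// ltW.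
pose G v := (2 * k)^-1 *: (e + quat_conj v * rho * v).
have k2 : 0 < 2 * k by rewrite mulr_gt0.
have quad_bound v v' r : `|v| <= r -> `|v'| <= r ->
    `|quat_conj v * rho * v - quat_conj v' * rho * v'|
      <= 2 * r * (K * k) * `|v - v'|.
  move=> vr v'r.
  have -> : quat_conj v * rho * v - quat_conj v' * rho * v' =
      quat_conj v * rho * (v - v') + quat_conj (v - v') * rho * v'.
    by apply: quatP => /=; ring.
  apply: le_trans (ler_normD _ _) _; rewrite !normqM !normq_conj.
  have h1 : `|v| * `|rho| <= r * (K * k) by apply: ler_pM.
  have h2 : `|rho| * `|v'| <= r * (K * k) by rewrite mulrC; apply: ler_pM.
  have -> : 2 * r * (K * k) * `|v - v'| =
    r * (K * k) * `|v - v'| + `|v - v'| * (r * (K * k)) by ring.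
  apply: lerD; first by rewrite ler_wpM2r.
  by rewrite -mulrA ler_wpM2l.
pose U := [set y : H | `|y| <= rad].
pose F y := rscale x (G (inner y x)).
have inU y : U y -> `|inner y x| <= rad.
  by move=> Uy; apply: le_trans (inner_cauchy _ _) _; rewrite x1 mulr1.
have G_bound v : `|v| <= rad -> `|G v| <= rad.
  move=> vr; rewrite normrZ normfV (gtr0_norm k2) ler_pdivrMl//.
  apply: le_trans (ler_normD _ _) _.
  have := @quad_bound v 0 rad vr; rewrite normr0 (ltW rad0) => /(_ isT).
  rewrite mulr0 !subr0 => h.
  have h' : 2 * rad * (K * k) * `|v| <= k * `|v|.
    by rewrite ler_wpM2r// (_ : 2 * rad * _ = k * (2 * (rad * K))) ?ger_pMr//; [lra|ring].
  have : k * `|v| <= k * rad by rewrite ler_pM2l.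
  lra.
have FU : set_fun U U F.
  by move=> y Uy; rewrite /U/= norm_rscale x1 mul1r; exact/G_bound/inU.
have Flip y y' : U y -> U y' -> `|F y - F y'| <= 1 / 2 * `|y - y'|.
  move=> Uy Uy'; rewrite -rscaleBr norm_rscale x1 mul1r -scalerBr normrZ.
  rewrite normfV (gtr0_norm k2) ler_pdivrMl// opprD addrACA subrr add0r.
  apply: le_trans (quad_bound _ _ _ (inU _ Uy) (inU _ Uy')) _.
  have : `|inner y x - inner y' x| <= `|y - y'|.
    by rewrite -innerBl; apply: le_trans (inner_cauchy _ _) _; rewrite x1 mulr1.
  move=> h; apply: le_trans (_ : k * `|y - y'| <= _); last by lra.
  apply: ler_pM => //; first by apply: mulr_ge0; apply: mulr_ge0 => //; exact: ltW.
  by rewrite (_ : 2 * rad * _ = k * (2 * (rad * K))) ?ger_pMr//; [lra|ring].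
pose F' : {fun U >-> U} := HB.pack F (isFun.Build _ _ _ _ F FU).
have ctr : is_contraction F'.
  exists (NngNum (divr_ge0 ler01 (ler0n R 2))); split => /=; first by lra.
  by move=> [y y'] [/= Uy Uy']; exact: Flip.
have Ucl : closed U.
  rewrite (_ : U = Num.norm @^-1` [set t | t <= rad]) //.
  by apply: closed_comp; [move=> ? _; exact: norm_continuous|exact: closed_le].
have [|y Uy yF] := banach_fixed_point ctr Ucl.
  by exists 0; rewrite /U/= normr0 ltW.
pose v := inner y x.
have vE : v = G v.
  rewrite {1}/v yF /= /F innerZl inner_norm x1 expr1n -/v.
  by apply: quatP => /=; ring.
have vr : `|v| <= rad by exact: inU.
have e_im : quat_conj e = - e by rewrite /e /w [in RHS](inner_op_skewC TS) opprK.
have rho_im : quat_conj rho = - rho.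
  by rewrite /rho [in RHS](inner_op_skewC TS) opprK.
(* Conjugation negates the right-hand side of the fixed-point equation, as [e] and [rho] are
   imaginary. *)
have v_im : quat_conj v = - v.
  rewrite {2}vE {1}vE /G -scalerN opprD -e_im.
  rewrite quat_conjZ quat_conjD !quat_conjM quat_conjK rho_im; congr (_ *: (_ + _)).
  by rewrite mulNr mulrN mulrA.
exists (x + rscale w v).
  rewrite addrAC subrr add0r norm_rscale.
  apply: le_trans rKeta; rewrite mulrC; apply: ler_pM => //.
  by have := BK x; rewrite x1 mulr1.
rewrite (inner_op_skewD TS) -/e -/w -/rho.
have -> : inner (B w) x = qreal (- k).
  rewrite (inner_op_skew TS) -/w inner_norm.
  by apply: quatP => //=; rewrite oppr0.
have : (2 * k) *: v = e + quat_conj v * rho * v.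
  by rewrite {1}vE scalerA divff ?scale1r// gt_eqF.
rewrite addrAC => <-; rewrite mulrq quat_conjZ v_im; apply: quatP => /=; ring.
Qed.

(** Normalising the isotropic vector [z = x + h] of [near_isotropic] gives a real value. It differs
    from [rdot (A x) x] by at most [24 K |h|], because [|z|^2 >= 1/4]. *)
Lemma near_real_value c eta : 0 < c -> 0 < eta ->
  exists2 eps, 0 < eps & forall x, `|x| = 1 -> c <= `|D x| ->
    imn (inner (T x) x) <= eps ->
    exists2 r, real_bild T r & `|r - rdot (A x) x| <= eta.
Proof.
move=> c0 eta0; have K0 := pair_ge0 TS.
pose eta' := Num.min (1 / 2) (eta / (30 * K + 1)).
have KK : 0 < 30 * K + 1 by lra.
have eta'0 : 0 < eta' by rewrite lt_min !divr_gt0.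
have eta'2 : eta' <= 1 / 2 by rewrite ge_min lexx.
have eta'K : eta' * (30 * K) <= eta.
  have : eta' * (30 * K + 1) <= eta by rewrite -ler_pdivlMr// ge_min lexx orbT.
  lra.
have [eps eps0 near] := near_isotropic c0 eta'0.
exists eps => // x x1 cx; rewrite /imn (quat_im_inner TS) => xeps.
rewrite -norm_op_skew in cx.
have [z zx iso] := near _ x1 cx xeps.
have [h zE] : exists h, z = x + h by exists (z - x); rewrite addrC subrK.
rewrite zE addrAC subrr add0r in zx.
have hz : 1 / 2 <= `|z| by rewrite zE; have := lerB_normD x h; rewrite x1; lra.
have z0 : z != 0 by rewrite -normr_gt0; lra.
exists (rdot (A z) z / `|z| ^+ 2); first exact: (real_bild_isotropic TS).
have zz : 1 / 4 <= `|z| ^+ 2.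
  by apply: le_trans (_ : (1 / 2) ^+ 2 <= _); [lra|rewrite ler_sqr ?nnegrE//; lra].
rewrite -[X in _ - X](@mulfK _ (`|z| ^+ 2)) ?gt_eqF//; last by lra.
rewrite -mulrBl normrM normfV (ger0_norm (sqr_ge0 _)) ler_pdivrMr; last by lra.
set a := rdot (A x) x.
have -> : rdot (A z) z - a * `|z| ^+ 2 =
    2 * (rdot (A x) h - a * rdot x h) + (rdot (A h) h - a * `|h| ^+ 2).
  rewrite -!rdot_norm zE (linearD A) !rdotE (op_re_sa TS h x) (rdotC h (A x)).
  by rewrite (rdotC h x) (rdot_norm x) x1 -/a; ring.
have aK : `|a| <= K.
  apply: le_trans (rdot_cauchy _ _) _.
  by have := op_re_bound TS x; rewrite x1 !mulr1.
have h0 : 0 <= `|h| by [].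
have b1 : `|rdot (A x) h| <= K * `|h|.
  apply: le_trans (rdot_cauchy _ _) _; rewrite ler_wpM2r//.
  by have := op_re_bound TS x; rewrite x1 mulr1.
have b2 : `|a * rdot x h| <= K * `|h|.
  rewrite normrM; apply: ler_pM => //.
  by apply: le_trans (rdot_cauchy _ _) _; rewrite x1 mul1r.
have hh : `|h| ^+ 2 <= `|h| by rewrite expr2 ler_piMl//; lra.
have b3 : `|rdot (A h) h| <= K * `|h|.
  apply: le_trans (rdot_cauchy _ _) _.
  apply: le_trans (_ : K * `|h| * `|h| <= _).
    by rewrite ler_wpM2r//; exact: (op_re_bound TS).
  by rewrite -mulrA -expr2 ler_wpM2l.
have b4 : `|a * `|h| ^+ 2| <= K * `|h|.
  by rewrite normrM (ger0_norm (sqr_ge0 _)); apply: ler_pM => //; exact: sqr_ge0.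
have Kh : K * `|h| <= K * eta' by rewrite ler_wpM2l.
have low : eta * (1 / 4) <= eta * `|z| ^+ 2 by rewrite ler_pM2l.
apply: le_trans (ler_normD _ _) _; rewrite normrM (ger0_norm (ler0n _ _)).
have := ler_normB (rdot (A x) h) (a * rdot x h).
have := ler_normB (rdot (A h) h) (a * `|h| ^+ 2).
lra.
Qed.

End real_values_existence.

(** * The closed upper bild is star-shaped around the S-spectrum *)

Section star_shape.
Context {R : realType}.
Implicit Types (a b t om tau : R) (p q g h u w W : quaternion R).

(** The vectors [g^* i g] with [|g|^2 = G] fill a sphere of radius [G] among the imaginary
    quaternions, so the norm of the sum takes all values between the two extremes of the triangle
    inequality. *)
Lemma rotate_to_norm b G t W : 0 <= b -> 0 <= G -> qre W = 0 ->
  `|G * b - `|W| | <= t -> t <= G * b + `|W| ->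
  exists2 g, `|g| ^+ 2 = G & `|b *: (quat_conj g * iq * g) + W| = t.
Proof.
move=> b0 G0 reW low up; have t0 : 0 <= t by exact: le_trans (normr_ge0 _) low.
have [u u1 uW] := rotate_to_cplx W.
have WE : imn W = `|W|.
  by apply: sqr_inj_ge0; rewrite ?imn_ge0// sqr_imn sqr_normq reW; ring.
rewrite reW WE in uW; set om := `|W| in low up uW.
have om0 : 0 <= om by exact: normr_ge0.
have Gb0 : 0 <= G * b by rewrite mulr_ge0.
have [c /andP[c_ge c_le] tc] : exists2 c, -1 <= c <= 1 &
    t ^+ 2 = (G * b) ^+ 2 + om ^+ 2 + 2 * (G * b * om) * c.
  have [z|nz] := eqVneq (G * b * om) 0.
    exists 1; first by rewrite lexx andbT; lra.
    have -> : t = G * b + om.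
      apply/eqP; rewrite eq_le up/=; apply: le_trans low.
      rewrite -ler_sqr ?nnegrE ?addr_ge0// real_normK ?num_real//.
      by rewrite le_eqVlt; apply/orP; left; apply/eqP; lra.
    by ring.
  have d0 : 0 < 2 * (G * b * om) by rewrite mulr_gt0// lt_neqAle eq_sym nz !mulr_ge0.
  exists ((t ^+ 2 - (G * b) ^+ 2 - om ^+ 2) / (2 * (G * b * om))); last first.
    by rewrite [X in _ + X]mulrC divfK ?gt_eqF//; ring.
  apply/andP; split.
    rewrite ler_pdivlMr//.
    have : (G * b - om) ^+ 2 <= t ^+ 2.
      by rewrite -[X in X <= _]real_normK ?num_real// ler_sqr ?nnegrE.
    lra.
  rewrite ler_pdivrMr// mul1r.
  have : t ^+ 2 <= (G * b + om) ^+ 2 by rewrite ler_sqr ?nnegrE ?addr_ge0.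
  lra.
(* Half-angle formulas: [m^* i m] has [i]-coordinate [c1^2 - s1^2 = c], the cosine prescribed by
   [tc]. *)
pose c1 := Num.sqrt ((1 + c) / 2); pose s1 := Num.sqrt ((1 - c) / 2).
have cc : c1 ^+ 2 = (1 + c) / 2 by rewrite sqr_sqrtr//; lra.
have ss : s1 ^+ 2 = (1 - c) / 2 by rewrite sqr_sqrtr//; lra.
have GG : Num.sqrt G ^+ 2 = G by rewrite sqr_sqrtr.
pose m := Quat c1 0 s1 0.
have mm : `|m| = 1.
  by apply: sqr_inj_ge0 => //; rewrite sqr_normq /= cc ss; field.
exists (Num.sqrt G *: (m * quat_conj u)).
  by rewrite normrZ normqM normq_conj u1 mm !mulr1 real_normK ?num_real.
have uu : u * quat_conj u = 1 by rewrite mulq_conj u1 expr1n.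
have -> : W = u * cplx 0 om * quat_conj u.
  by rewrite -uW !mulrA uu mul1r -mulrA uu mulr1.
rewrite quat_conjZ !scaleqAr !scaleqAl !scalerA -mulrA -expr2 GG.
rewrite quat_conjM quat_conjK.
have -> : u * quat_conj m * iq * (m * quat_conj u) =
    u * (quat_conj m * iq * m) * quat_conj u by rewrite !mulrA.
rewrite -scaleqAl -scaleqAr -mulrDl -mulrDr !normqM normq_conj u1 mul1r mulr1.
apply: sqr_inj_ge0 => //; rewrite sqr_normq /= tc.
have -> : c = c1 ^+ 2 - s1 ^+ 2 by rewrite cc ss; field.
have s2 : s1 ^+ 2 = 1 - c1 ^+ 2 by rewrite ss cc; field.
by ring: s2.
Qed.

(** [G] is what makes [|g|^2 + (1 - tau) (1 - |h|^2) = 1], so that the modified vector stays a unit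
    vector. The real part is then right for every such [g], and the phase of [g] adjusts the
    imaginary norm. *)
Lemma choose_phase a b r be tau h (G := tau + (1 - tau) * `|h| ^+ 2) :
  0 <= b -> 0 <= be -> 0 <= tau <= 1 -> exists2 g, `|g| ^+ 2 = G &
    let M := quat_conj g * cplx a b * g
       + (1 - tau) *: (cplx r be - quat_conj h * cplx a b * h) in
    qre M = (1 - tau) * r + tau * a /\ imn M = (1 - tau) * be + tau * b.
Proof.
move=> b0 be0 /andP[t0 t1].
have ct0 : 0 <= 1 - tau by lra.
pose U := quat_conj h * iq * h.
have nU : `|U| = `|h| ^+ 2.
  by rewrite /U !normqM normq_conj norm_iq mulr1 expr2.
pose W : quaternion R := (1 - tau) *: (be *: iq - b *: U).
have reW : qre W = 0 by rewrite /W /U /=; ring.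
have nbi : `|be *: (iq : quaternion R)| = be by rewrite normrZ norm_iq mulr1 ger0_norm.
have nbU : `|b *: U| = b * `|h| ^+ 2 by rewrite normrZ nU ger0_norm.
have nW : `|W| = (1 - tau) * `|be *: iq - b *: U| by rewrite normrZ ger0_norm.
have h0 : 0 <= `|h| ^+ 2 by rewrite sqr_ge0.
have tri1 : (1 - tau) * `|be *: iq - b *: U| <= (1 - tau) * (be + b * `|h| ^+ 2).
  by rewrite ler_wpM2l// -[X in _ <= X + _]nbi -nbU ler_normB.
have tri2 : (1 - tau) * (b * `|h| ^+ 2 - be) <= (1 - tau) * `|be *: iq - b *: U|.
  rewrite ler_wpM2l// -nbU -[X in _ - X]nbi distrC; exact: lerB_dist.
have tri3 : (1 - tau) * (be - b * `|h| ^+ 2) <= (1 - tau) * `|be *: iq - b *: U|.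
  rewrite ler_wpM2l// -nbU -[X in X - _]nbi; exact: lerB_dist.
have G0 : 0 <= G by rewrite addr_ge0// mulr_ge0.
have tb0 : 0 <= tau * b by rewrite mulr_ge0.
have tbe0 : 0 <= (1 - tau) * be by rewrite mulr_ge0.
have [||g gG gt] := @rotate_to_norm b G ((1 - tau) * be + tau * b) W b0 G0 reW.
- by rewrite ler_norml /G nW; apply/andP; split; lra.
- by rewrite /G nW; lra.
exists g => //= ; split.
  have : qre (quat_conj g * cplx a b * g) = a * `|g| ^+ 2.
    by rewrite sqr_normq /=; ring.
  have : qre (quat_conj h * cplx a b * h) = a * `|h| ^+ 2.
    by rewrite sqr_normq /=; ring.
  by rewrite gG /G /= => -> ->; ring.
rewrite -gt /imn; congr `|_|; rewrite /W /U.
by apply: quatP => /=; ring.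
Qed.

End star_shape.

Section star_shaped_bild.
Context {R : realType} {H : rightQuaternionicHilbertType R}.
Implicit Types (x y z : H) (a b d s tau : R) (p q g h : quaternion R).
Context {K : R} {T S : {linear H -> H}} (TS : normal_pair K T S).

(** By normality, an approximate eigenvector of [T] for [p] is one of the adjoint for [p^*]. *)
Lemma norm_adj_eigen x p :
  `|S x - rscale x (quat_conj p)| = `|T x - rscale x p|.
Proof.
apply: sqr_inj_ge0 => //; rewrite !normrD_sqr !normrN (norm_adj TS).
rewrite !norm_rscale normq_conj; congr (_ + _ * _ + _).
rewrite !rdotNr /rdot !innerZr quat_conjK [inner (S x) x]inner_conj -(pair_adj TS) /=.
by ring.
Qed.

(* Up to small errors, [T] acts diagonally with respect to an approximate
   eigenvector [x] and a vector orthogonal to it, since [x] is also an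
   approximate eigenvector of the adjoint. *)
Lemma approximate_diagonal p d x y g s : `|x| = 1 -> `|T x - rscale x p| <= d ->
  inner y x = 0 -> `|y| <= 1 -> `|g| <= 1 -> 0 <= s <= 1 ->
  let z := rscale x g + s *: y in
  `|inner (T z) z - (quat_conj g * p * g + s ^+ 2 *: inner (T y) y)| <= 3 * d.
Proof.
move=> x1; have := norm_adj_eigen x p.
have [E TxE] : exists E, T x = E + rscale x p.
  by exists (T x - rscale x p); rewrite subrK.
have [E' SxE] : exists E', S x = E' + rscale x (quat_conj p).
  by exists (S x - rscale x (quat_conj p)); rewrite subrK.
rewrite TxE SxE !addrK => nE' Ed yx y1 g1 /andP[s0 s1]; cbv zeta; set z := _ + s *: y.
have E'd : `|E'| <= d by rewrite nE'.
have xy : inner x y = 0 by rewrite inner_conj yx; apply: quatP => /=; ring.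
have d0 : 0 <= d by exact: le_trans (normr_ge0 _) Ed.
have xx : inner x x = 1 by rewrite inner_norm x1 expr1n.
have Tyx : inner (T y) x = inner y E'.
  by rewrite (pair_adj TS) SxE innerDr innerZr yx mulr0 addr0.
have -> : inner (T z) z = (quat_conj g * p * g + s ^+ 2 *: inner (T y) y)
    + (quat_conj g * inner E x * g + s *: (inner E y * g)
       + s *: (quat_conj g * inner y E')).
  rewrite /z (linearD T) (linearZZ T) (pair_rscale TS) TxE.
  rewrite innerDl !innerDr !innerZl !innerZ !innerZr !inner_scaler Tyx.
  rewrite !innerDl !innerZl xx xy.
  by apply: quatP => /=; ring.
rewrite [X in `|X|]addrAC subrr add0r.
have Ex : `|inner E x| <= d.
  by apply: le_trans (inner_cauchy _ _) _; rewrite x1 mulr1.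
have Ey : `|inner E y| <= d.
  apply: le_trans (inner_cauchy _ _) _; rewrite -[leRHS]mulr1.
  exact: ler_pM.
have yE' : `|inner y E'| <= d.
  apply: le_trans (inner_cauchy _ _) _; rewrite -[leRHS]mul1r.
  exact: ler_pM.
apply: le_trans (ler_normD _ _) _.
rewrite (_ : 3 * d = d + d + d); last by ring.
apply: lerD; first (apply: le_trans (ler_normD _ _) _; apply: lerD).
- rewrite !normqM normq_conj -[leRHS]mulr1; apply: ler_pM => //.
  by rewrite -[leRHS]mul1r; apply: ler_pM.
- rewrite normrZ normqM ger0_norm// -[leRHS]mul1r; apply: ler_pM => //.
  by rewrite -[leRHS]mulr1; apply: ler_pM.
- rewrite normrZ normqM normq_conj ger0_norm// -[leRHS]mul1r; apply: ler_pM => //.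
  by rewrite -[leRHS]mul1r; apply: ler_pM.
Qed.

(** From [y = x h + y'] one passes to [z = x g + sqrt (1 - tau) y'], with [g] given by
    [choose_phase]; near diagonality controls both values. *)
Lemma upper_bild_star a b q tau eps : 0 <= b ->
  approximate_eigenvalue_of T (cplx a b) -> upper_bild T q ->
  0 <= tau <= 1 -> 0 < eps ->
  exists2 w, upper_bild T w & `|w - ((1 - tau) *: q + tau *: cplx a b)| <= eps.
Proof.
move=> b0 ap [[y /= y1 yq] [[qj0 qk0] qi0]] t01 eps0.
have [t0 t1] := andP t01.
(* The value of [z] is known up to [6 d]; this error is counted once for the real part and once for
   [imn]. *)
pose d := eps / 12; have d0 : 0 < d by rewrite divr_gt0.
have [x x1 xd] := ap _ d0.
pose h := inner y x; pose y' := y - rscale x h.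
have y'x : inner y' x = 0 by rewrite innerBl innerZl inner_norm x1 expr1n mul1r subrr.
have yE : y = rscale x h + y' by rewrite addrC subrK.
have rxy g : rdot (rscale x g) y' = 0.
  by rewrite rdotC /rdot innerZr y'x mulr0.
have ny' : `|y'| ^+ 2 = 1 - `|h| ^+ 2.
  have : `|y| ^+ 2 = 1 by rewrite y1 expr1n.
  by rewrite {1}yE normrD_sqr rxy norm_rscale x1 mul1r; lra.
have h1 : `|h| <= 1 by have := inner_cauchy y x; rewrite y1 x1 mulr1.
have y'1 : `|y'| <= 1.
  by rewrite -ler_sqr ?nnegrE// ny' expr1n; have := sqr_ge0 `|h|; lra.
have h2 : `|h| ^+ 2 <= 1 by rewrite -[leRHS](expr1n _ 2) ler_sqr ?nnegrE.
have [g gG gM] := @choose_phase _ a b (qre q) (qi q) tau h b0 qi0 t01.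
have qE : q = cplx (qre q) (qi q) by apply: quatP.
cbv zeta in gM; rewrite -qE in gM; case: gM => reM imM.
set M := (X in qre X) in reM; rewrite -/M in imM.
have g1 : `|g| <= 1.
  rewrite -ler_sqr ?nnegrE// gG expr1n.
  have : (1 - tau) * `|h| ^+ 2 <= (1 - tau) * 1 by rewrite ler_wpM2l//; lra.
  lra.
pose s := Num.sqrt (1 - tau).
have ss : s ^+ 2 = 1 - tau by rewrite sqr_sqrtr//; lra.
have s01 : 0 <= s <= 1.
  rewrite sqrtr_ge0/= -(ler_sqr (y := 1)) ?nnegrE ?sqrtr_ge0// ss expr1n; lra.
have one01 : 0 <= (1 : R) <= 1 by rewrite ler01 lexx.
have errh := approximate_diagonal x1 xd y'x y'1 h1 one01.
have errg := approximate_diagonal x1 xd y'x y'1 g1 s01.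
rewrite /= scale1r -yE expr1n scale1r yq in errh.
rewrite /= ss in errg; set z := rscale x g + s *: y' in errg.
have z1 : `|z| = 1.
  apply: sqr_inj_ge0 => //; rewrite expr1n normrD_sqr rdotZr rxy norm_rscale x1.
  rewrite mul1r gG normrZ exprMn real_normK ?num_real// ss ny'; ring.
have valM : `|inner (T z) z - M| <= 6 * d.
  have -> : inner (T z) z - M =
      (inner (T z) z - (quat_conj g * cplx a b * g + (1 - tau) *: inner (T y') y'))
      - (1 - tau) *: (q - (quat_conj h * cplx a b * h + inner (T y') y')).
    by rewrite /M; apply: quatP => /=; ring.
  apply: le_trans (ler_normB _ _) _.
  have : `|(1 - tau) *: (q - (quat_conj h * cplx a b * h + inner (T y') y'))|
      <= 1 * (3 * d).
    rewrite normrZ; apply: ler_pM => //.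
    by rewrite ger0_norm; lra.
  by move: errg; lra.
exists (cplx (qre (inner (T z) z)) (imn (inner (T z) z))).
  exact: (upper_bild_fold TS).
set v := inner (T z) z in valM *.
have -> : cplx (qre v) (imn v) - ((1 - tau) *: q + tau *: cplx a b) =
    cplx (qre (v - M)) (imn v - imn M).
  rewrite {1}qE (_ : qre (v - M) = qre v - qre M)// reM imM.
  by apply: quatP; rewrite /cplx /=; ring.
apply: le_trans (normq_cplx_le _ _) _.
have := abs_qre_le (v - M); have := imn_lipschitz v M.
rewrite /d in valM; lra.
Qed.

End star_shaped_bild.

(** * Convex hulls in the complex plane *)

Lemma closure_normP {R : realType} {V : normedModType R} (A : set V) q :
  closure A q <-> forall e : R, 0 < e -> exists2 w, A w & `|w - q| <= e.
Proof.
split=> [cl e e0|ap B /nbhs_normP[e /= e0 eB]].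
  have [w [Aw qw]] := cl _ (nbhsx_ballx q e e0); exists w => //.
  by move: qw; rewrite -ball_normE /= distrC => /ltW.
have [|w Aw wq] := ap (e / 2); first by rewrite divr_gt0.
exists w; split => //; apply: eB; rewrite /= distrC.
by apply: le_lt_trans wq _; rewrite ltr_pdivrMr// mulr2n mulrDr mulr1 ltrDl.
Qed.

Section convex_hulls.
Context {R : realType} {E : lmodType R}.
Implicit Types (A B Y : set E) (x y z p : E) (s t : R).

Lemma convex_setP A : @convex_set R E A <->
  forall x y t, 0 <= t <= 1 -> A x -> A y -> A ((1 - t) *: x + t *: y).
Proof.
split=> [cA x y t /andP[t0 t1] Ax Ay|cA x y t /set_mem Ax /set_mem Ay].
  rewrite addrC; have := cA y x (Itv01 t0 t1) (mem_set Ay) (mem_set Ax).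
  by move/set_mem.
have t01 : 0 <= t%:num <= 1 by rewrite ge0 le1.
by apply: mem_set; have := cA _ _ _ t01 Ay Ax; rewrite addrC.
Qed.

Lemma convex_convex_hull A : @convex_set R E (convex_hull A).
Proof.
apply/convex_setP => x y t t01 hx hy B [cB AB].
by move/convex_setP: (cB); apply => //; [exact: (hx B)|exact: (hy B)].
Qed.

Definition star_kernel Y : set E :=
  [set p | forall y t, Y y -> 0 <= t <= 1 -> Y ((1 - t) *: y + t *: p)].

(** Moving towards [(1 - s) p1 + s p2] by [t] amounts to moving towards [p1] by [r] and then towards
    [p2] by [t * s], where [(1 - t s) r = t (1 - s)]. *)
Lemma star_kernel_convex Y : @convex_set R E (star_kernel Y).
Proof.
apply/convex_setP => p1 p2 s /andP[s0 s1] k1 k2 y t Yy /andP[t0 t1].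
have [/eqP st1|st1] := eqVneq (t * s) 1.
  have [-> ->] : t = 1 /\ s = 1.
    have : t * s <= s by rewrite ler_piMl.
    have : t * s <= t by rewrite ler_piMr.
    by move/eqP: st1 => ->; split; lra.
  have := k2 y 1 Yy; rewrite subrr !scale0r !add0r !scale1r; apply.
  by rewrite ler01 lexx.
have ts1 : t * s < 1 by rewrite lt_neqAle st1 mulr_ile1.
have ts0 : 0 <= t * s by rewrite mulr_ge0.
have d0 : 0 < 1 - t * s by rewrite subr_gt0.
pose r := t * (1 - s) / (1 - t * s).
have r01 : 0 <= r <= 1.
  rewrite divr_ge0 ?mulr_ge0 ?subr_ge0 ?(ltW ts1)//= ler_pdivrMr// mul1r; lra.
have ts01 : 0 <= t * s <= 1 by rewrite ts0 ltW.
have := k2 _ _ (k1 _ _ Yy r01) ts01.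
rewrite !scalerDr !scalerA addrA; congr (Y (_ *: _ + _ *: _ + _ *: _)).
  by rewrite /r; field; rewrite gt_eqF.
by rewrite /r; field; rewrite gt_eqF.
Qed.

Lemma convex_hull_star_kernel A Y : A `<=` star_kernel Y ->
  convex_hull A `<=` star_kernel Y.
Proof. by apply: smallest_sub; exact: star_kernel_convex. Qed.

Definition segments A B : set E :=
  [set z | exists x y t, [/\ A x, B y, 0 <= t <= 1 & z = (1 - t) *: x + t *: y]].

(** In a combination of two segment points, the weights on [A] and those on [B] are regrouped and
    normalised separately. *)
Lemma convex_segments A B : @convex_set R E A -> @convex_set R E B ->
  @convex_set R E (segments A B).
Proof.
move=> /convex_setP cA /convex_setP cB; apply/convex_setP.
move=> z z' s /andP[s0 s1] [x [y [t [Ax By /andP[t0 t1] ->]]]].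
move=> [x' [y' [t' [Ax' By' /andP[t'0 t'1] ->]]]].
have weights (a b : R) : 0 <= a -> 0 <= b ->
    exists2 r, 0 <= r <= 1 & a = (a + b) * (1 - r) /\ b = (a + b) * r.
  move=> a0 b0; have [ab0|ab0] := eqVneq (a + b) 0.
    by exists 0; [rewrite lexx ler01|rewrite ab0; split; lra].
  have ab : 0 < a + b by rewrite lt_neqAle eq_sym ab0 addr_ge0.
  exists (b / (a + b)); last by split; field.
  by rewrite divr_ge0 ?(ltW ab)//= ler_pdivrMr// mul1r lerDr.
have s'0 : 0 <= 1 - s by rewrite subr_ge0.
have [||u u01 [u1 u2]] := weights ((1 - s) * (1 - t)) (s * (1 - t')).
- by rewrite mulr_ge0 ?subr_ge0.
- by rewrite mulr_ge0 ?subr_ge0.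
have [||v v01 [v1 v2]] := weights ((1 - s) * t) (s * t'); rewrite ?mulr_ge0//.
exists ((1 - u) *: x + u *: x'), ((1 - v) *: y + v *: y'), ((1 - s) * t + s * t').
split; [exact: cA|exact: cB| |].
  rewrite addr_ge0 ?mulr_ge0//=.
  have : (1 - s) * t <= (1 - s) * 1 by rewrite ler_wpM2l.
  have : s * t' <= s * 1 by rewrite ler_wpM2l.
  lra.
rewrite (_ : 1 - ((1 - s) * t + s * t') = (1 - s) * (1 - t) + s * (1 - t')); last by ring.
rewrite !scalerDr !scalerA -u1 -u2 -v1 -v2.
by rewrite addrACA.
Qed.

(** Convex combinations of [n + 1] points of [A], built as iterated joins so that compactness passes
    from each stage to the next. *)
Fixpoint iter_segments A n : set E :=
  if n is m.+1 then segments (iter_segments A m) A else A.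

Lemma sub_iter_segments A n : A `<=` iter_segments A n.
Proof.
elim: n => [//|n IH] x Ax; exists x, x, 0; split => //; first exact: IH.
  by rewrite lexx ler01.
by rewrite subr0 scale1r scale0r addr0.
Qed.

Lemma iter_segments_sub_hull A n : iter_segments A n `<=` convex_hull A.
Proof.
elim: n => [|n IH]; first exact: sub_gen_smallest.
move=> _ [x [y [t [/IH hx Ay t01 ->]]]].
have /convex_setP cH := @convex_convex_hull A.
by apply: cH => //; exact: sub_gen_smallest.
Qed.

Lemma iter_segmentsP A n z : iter_segments A n z <->
  exists (w : 'I_n.+1 -> R) (k : 'I_n.+1 -> E),
  [/\ forall i, 0 <= w i, \sum_i w i = 1, forall i, A (k i) &
      z = \sum_i w i *: k i].
Proof.
elim: n z => [|n IH] z.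
  split=> [Az|[w [k [_ w1 Ak ->]]]].
    exists (fun=> 1), (fun=> z); split => //; first by rewrite big_ord1.
    by rewrite big_ord1 scale1r.
  by move: w1; rewrite !big_ord1 => ->; rewrite scale1r.
have lift_max (i : 'I_n.+1) : lift ord_max i = widen_ord (leqnSn _) i.
  by apply: val_inj; rewrite /= /bump leqNgt ltn_ord.
split.
  move=> [x [y [t [/IH [w [k [w0 w1 Ak ->]]] Ay /andP[t0 t1] ->]]]].
  exists (fun i => if unlift ord_max i is Some j then (1 - t) * w j else t).
  exists (fun i => if unlift ord_max i is Some j then k j else y).
  have sumw (V : lmodType R) (F : 'I_n.+1 -> V) (G : V) :
    \sum_(i < n.+2) (if unlift ord_max i is Some j then F j else G) =
    \sum_(i < n.+1) F i + G.
    rewrite big_ord_recr /= unlift_none; congr (_ + _).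
    by apply: eq_bigr => i _; rewrite -lift_max liftK.
  split.
  - by move=> i; case: unliftP => [j _|_] //; rewrite mulr_ge0// subr_ge0.
  - by rewrite (@sumw R^o) -mulr_sumr w1 mulr1 subrK.
  - by move=> i; case: unliftP.
  - rewrite scaler_sumr -(sumw E); apply: eq_bigr => i _.
    by case: unliftP => [j _|_]; rewrite ?scalerA.
move=> [w [k [w0 w1 Ak ->]]].
rewrite big_ord_recr /=; rewrite big_ord_recr /= in w1.
set W := \sum_(i < n.+1) w _ in w1; set t := w ord_max in w1 *.
have W0 : 0 <= W by apply: sumr_ge0 => i _; exact: w0.
have t0 : 0 <= t by exact: w0.
have t01 : 0 <= t <= 1 by rewrite t0; lra.
have WE : W = 1 - t by lra.
have [Wz|Wz] := eqVneq W 0.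
  exists (k ord_max), (k ord_max), t; split => //.
    exact: sub_iter_segments.
  rewrite -WE Wz scale0r; congr (_ + _); apply: big1 => i _.
  have /psumr_eq0P h : forall i : 'I_n.+1, true -> 0 <= w (widen_ord (leqnSn _) i).
    by move=> *; exact: w0.
  by rewrite h ?scale0r.
exists (\sum_(i < n.+1) (w (widen_ord (leqnSn _) i) / W) *: k (widen_ord (leqnSn _) i)).
exists (k ord_max), t; split => //.
  apply/IH; exists (fun i => w (widen_ord (leqnSn _) i) / W).
  exists (fun i => k (widen_ord (leqnSn _) i)); split => //.
  - by move=> i; rewrite divr_ge0.
  - by rewrite -mulr_suml divff.
congr (_ + _); rewrite scaler_sumr -WE; apply: eq_bigr => i _.
by rewrite scalerA mulrCA divff ?mulr1.
Qed.

End convex_hulls.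

(** * Caratheodory's theorem and separation in the plane *)

Section planar_sets.
Context {R : realType}.
Implicit Types (K X : set (quaternion R)) (z : quaternion R) (s t : R).

Lemma continuous_dist {V : normedModType R} (v : V) :
  continuous (fun w : V => `|v - w|).
Proof.
move=> w; apply: cvg_norm; apply: cvgB; first exact: cvg_cst.
exact: cvg_id.
Qed.

Lemma continuous_lincomb {V : normedModType R} (u v : V) :
  continuous (fun x : R * R => x.1 *: u + x.2 *: v).
Proof.
move=> x; apply: cvgD; apply: cvgZ; try exact: cvg_cst.
  exact: cvg_fst.
exact: cvg_snd.
Qed.

Lemma compact_segments {E : normedModType R} (A B : set E) :
  compact A -> compact B -> compact (segments A B).
Proof.
move=> cA cB.
pose f (x : E * E * R) : E := (1 - x.2) *: x.1.1 + x.2 *: x.1.2.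
have -> : segments A B = f @` (A `*` B `*` `[0, 1]%classic).
  apply/seteqP; split=> [z [x [y [t [Ax By t01 ->]]]]|z].
    by exists (x, y, t) => //; split => //=; rewrite in_itv/=.
  move=> [[[x y] t] [[/= Ax By]]]; rewrite in_itv/= => t01 <-.
  by exists x, y, t.
apply: continuous_compact.
  apply: continuous_subspaceT => x.
  have c1 : (fun x : E * E * R => x.1.1) @ x --> x.1.1.
    by apply: (@cvg_comp _ _ _ fst fst); [exact: cvg_fst|exact: cvg_fst].
  have c2 : (fun x : E * E * R => x.1.2) @ x --> x.1.2.
    by apply: (@cvg_comp _ _ _ fst snd); [exact: cvg_fst|exact: cvg_snd].
  have c3 : (fun x : E * E * R => x.2) @ x --> x.2 by exact: cvg_snd.
  by apply: cvgD; apply: cvgZ => //; apply: cvgB => //; exact: cvg_cst.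
by do 2?apply: compact_setX => //; exact: segment_compact.
Qed.

Lemma compact_iter_segments {E : normedModType R} (A : set E) n :
  compact A -> compact (iter_segments A n).
Proof. by move=> cA; elim: n => [//|n IH]; exact: compact_segments. Qed.

(** The 4 by 3 matrix with rows [(1, qre, qi)] has a nonzero left kernel vector; its entries sum to
    0, so one of them is positive. *)
Lemma planar_affine_dependence (k : 'I_4 -> quaternion R) :
  (forall i, complex_plane (k i)) -> exists la : 'I_4 -> R,
  [/\ \sum_i la i = 0, \sum_i la i *: k i = 0 & exists i, 0 < la i].
Proof.
move=> kC.
pose M : 'M[R]_(4, 3) := \matrix_(i, j)
  (if (nat_of_ord j == 0)%N then 1
   else if (nat_of_ord j == 1)%N then qre (k i) else qi (k i)).
have : kermx M != 0.
  rewrite -mxrank_eq0 mxrank_ker -lt0n subn_gt0.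
  exact: leq_ltn_trans (rank_leq_col M) _.
move=> /rowV0Pn[u /sub_kermxP uM u0].
have uME j : \sum_i u 0 i * M i j = 0.
  by have /rowP/(_ j) := uM; rewrite !mxE.
have sum0 : \sum_i u 0 i = 0.
  rewrite -[RHS](uME (inord 0)); apply: eq_bigr => i _.
  by rewrite mxE inordK ?mulr1.
exists (fun i => u 0 i); split => //.
  have lin (f : quaternion R -> R) : f 0 = 0 -> {morph f : x y / x + y} ->
      (forall a x, f (a *: x) = a * f x) ->
      f (\sum_i u 0 i *: k i) = \sum_i u 0 i * f (k i).
    move=> f0 fD fZ; rewrite (big_morph f fD f0).
    by apply: eq_bigr => i _; rewrite fZ.
  apply: quatP; rewrite lin//.
  - rewrite -[RHS](uME (inord 1)); apply: eq_bigr => i _.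
    by rewrite mxE inordK.
  - rewrite -[RHS](uME (inord 2)); apply: eq_bigr => i _.
    by rewrite mxE inordK.
  - by apply: big1 => i _; rewrite (kC i).1 mulr0.
  - by apply: big1 => i _; rewrite (kC i).2 mulr0.
apply: contrapT => npos; move/eqP: u0; apply; apply/rowP => i; rewrite mxE.
have le0 j : u 0 j <= 0.
  by rewrite leNgt; apply/negP => uj; apply: npos; exists j.
have := @psumr_eq0P _ _ predT (fun j => - u 0 j).
rewrite sumrN sum0 oppr0 => h; apply/eqP; rewrite -oppr_eq0; apply/eqP.
by apply: h => // j _; rewrite oppr_ge0.
Qed.

(** Subtracting the largest multiple of an affine dependence that keeps the four weights nonnegative
    annihilates one of them. *)
Lemma planar_caratheodory K : K `<=` complex_plane ->
  iter_segments K 3 `<=` iter_segments K 2.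
Proof.
move=> KC z /iter_segmentsP [w [k [w0 w1 Kk zE]]].
have [la [la0 lak [j laj]]] := planar_affine_dependence (fun i => KC _ (Kk i)).
have [i0 lai0 mini] := @arg_minP _ _ _ j (fun i => 0 < la i) (fun i => w i / la i) laj.
pose s := w i0 / la i0.
have s0 : 0 <= s by rewrite divr_ge0// ltW.
pose w' i := w i - s * la i.
have w'0 i : 0 <= w' i.
  rewrite subr_ge0; have [lai|lai] := ltP 0 (la i).
    by rewrite -ler_pdivlMr//; exact: mini.
  by apply: le_trans (w0 i); rewrite mulr_ge0_le0.
have w'i0 : w' i0 = 0 by rewrite /w' /s divfK ?subrr// gt_eqF.
have w'1 : \sum_i w' i = 1 by rewrite sumrB -mulr_sumr la0 mulr0 subr0.
have w'z : \sum_i w' i *: k i = z.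
  under eq_bigr do rewrite scalerBl -scalerA.
  by rewrite sumrB -scaler_sumr lak scaler0 subr0.
apply/iter_segmentsP; exists (fun i => w' (lift i0 i)), (fun i => k (lift i0 i)).
split => //.
  by rewrite -w'1 (bigD1_ord i0)//= w'i0 add0r.
by rewrite -w'z (bigD1_ord i0)//= w'i0 scale0r add0r.
Qed.

(** By Caratheodory, the triangles with vertices in [K] form a set star-shaped around each point of
    [K], hence around each point of the hull; [t = 1] puts that point in the set. *)
Lemma planar_convex_hull K : K `<=` complex_plane ->
  convex_hull K = iter_segments K 2.
Proof.
move=> KC; apply/seteqP; split; last exact: iter_segments_sub_hull.
have Kker : K `<=` star_kernel (iter_segments K 2).
  move=> k Kk y t yJ t01; apply: planar_caratheodory => //.
  by exists y, k, t.
move=> p pK; have [k0 Kk0] : K !=set0.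
  apply: contrapT => /nonemptyPn K0.
  have : convex_hull K `<=` set0.
    apply: smallest_sub; last by rewrite K0.
    by apply/convex_setP.
  by move/(_ _ pK).
have t1 : 0 <= (1 : R) <= 1 by rewrite ler01 lexx.
have := convex_hull_star_kernel Kker pK (sub_iter_segments 2 Kk0) t1.
by rewrite subrr scale0r add0r scale1r.
Qed.

Lemma compact_planar_convex_hull K : K `<=` complex_plane -> compact K ->
  compact (convex_hull K).
Proof. by move=> KC cK; rewrite planar_convex_hull//; exact: compact_iter_segments. Qed.

Lemma planar_compact (A : set (quaternion R)) M : A `<=` complex_plane ->
  closed A -> (forall q, A q -> `|q| <= M) -> compact A.
Proof.
move=> AC clA AM.
pose Q : set (R * R) := `[- M, M]%classic `*` `[- M, M]%classic.
apply: (@subclosed_compact _ _ ((fun x : R * R => cplx x.1 x.2) @` Q)) => //; last first.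
  move=> q Aq; have [qj0 qk0] := AC _ Aq; exists (qre q, qi q).
    have := AM _ Aq; have := abs_qre_le q; have := abs_qi_le q => hi hr hM.
    split; rewrite /= in_itv/= -ler_norml; [exact: le_trans hr hM|exact: le_trans hi hM].
  by apply: quatP.
apply: continuous_compact; last by apply: compact_setX; exact: segment_compact.
apply: continuous_subspaceT.
have -> : (fun x : R * R => cplx x.1 x.2) =
    (fun x : R * R => x.1 *: cplx 1 0 + x.2 *: cplx 0 1).
  by apply/funext => y; apply: quatP => /=; ring.
exact: continuous_lincomb.
Qed.

(** The normal is [z - p], with [p] the point of [X] nearest to [z]: moving slightly from [p]
    towards another point of [X] does not reduce the distance. *)
Lemma planar_separation X z : X `<=` complex_plane -> compact X -> X !=set0 ->
  @convex_set R (quaternion R) X -> complex_plane z -> ~ X z ->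
  exists al be m, m < al * qre z + be * qi z /\
    forall w, X w -> al * qre w + be * qi w <= m.
Proof.
move=> XC cX X0 /convex_setP convX [zj zk] nXz.
have [|p /set_mem Xp pmin] := @compact_EVT_min _ _ (fun w => `|z - w|) X X0 cX.
  by apply: continuous_subspaceT; exact: continuous_dist.
have [pj pk] := XC _ Xp.
set al := qre (z - p); set be := qi (z - p).
have sq (w : quaternion R) : complex_plane w -> `|w| ^+ 2 = qre w ^+ 2 + qi w ^+ 2.
  by move=> [wj wk]; rewrite sqr_normq wj wk; ring.
have zpC : complex_plane (z - p) by split => /=; rewrite ?zj ?pj ?zk ?pk subrr.
have zp : 0 < `|z - p| ^+ 2.
  rewrite exprn_gt0// normr_gt0 subr_eq0; apply/eqP => zp.
  by apply: nXz; rewrite zp.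
exists al, be, (al * qre p + be * qi p); split.
  have := sq _ zpC; rewrite -/al -/be => sqz; rewrite sqz in zp.
  have : al * qre z + be * qi z = al * qre p + be * qi p + (al ^+ 2 + be ^+ 2).
    by rewrite /al /be /=; ring.
  lra.
move=> w Xw; have [wj wk] := XC _ Xw.
pose e := w - p; have eC : complex_plane e by split => /=; rewrite ?wj ?pj ?wk ?pk subrr.
have main t : 0 < t <= 1 -> 2 * (al * qre e + be * qi e) <= t * `|e| ^+ 2.
  move=> /andP[t0 t1]; have t01 : 0 <= t <= 1 by rewrite ltW.
  have := pmin _ (mem_set (convX _ _ _ t01 Xp Xw)).
  have -> : z - ((1 - t) *: p + t *: w) = (z - p) - t *: e.
    by apply: quatP => /=; ring.
  have tC : complex_plane (z - p - t *: e).
    by split => /=; rewrite ?zj ?pj ?zk ?pk ?wj ?wk; ring.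
  rewrite -ler_sqr ?nnegrE// (sq _ zpC) (sq _ tC) (sq _ eC) -/al -/be.
  rewrite (_ : qre (z - p - t *: e) = al - t * qre e)//.
  rewrite (_ : qi (z - p - t *: e) = be - t * qi e)// => h.
  by rewrite -(ler_pM2l t0); lra.
suff : al * qre e + be * qi e <= 0 by rewrite /e /=; lra.
rewrite leNgt; apply/negP => pos; set d := _ + _ in main pos.
have ee : 0 <= `|e| ^+ 2 by rewrite sqr_ge0.
pose t := Num.min 1 (d / (`|e| ^+ 2 + 1)).
have t0 : 0 < t by rewrite lt_min ltr01 divr_gt0// ltr_wpDl.
have t1 : t <= 1 by rewrite ge_min lexx.
have : 2 * d <= t * `|e| ^+ 2 by apply: main; rewrite t0 t1.
have : t * (`|e| ^+ 2 + 1) <= d.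
  by rewrite -ler_pdivlMr ?ge_min ?lexx ?orbT// ltr_wpDl.
lra.
Qed.

End planar_sets.

(** * Support half-planes of the upper bild *)

Section upper_spectrum.
Context {R : realType} {H : rightQuaternionicHilbertType R}.
Implicit Types (x y z w : H) (a b c d r t al be ga la eta : R) (p q : quaternion R).
Context {K : R} {T S : {linear H -> H}} (TS : normal_pair K T S).
Local Notation A := (op_re T S).
Local Notation D := (op_im T S).
Local Notation op_comb := (@op_comb R H T S).

Lemma upper_S_spectrum_cplx q : upper_S_spectrum T q ->
  [/\ q = cplx (qre q) (qi q), 0 <= qi q & approximate_eigenvalue_of T q].
Proof.
move=> [specq [[qj0 qk0] /= qi0]].
have qE : q = cplx (qre q) (qi q) by apply: quatP.
by split => //; rewrite qE; apply: (S_spectrum_approximate_eigenvalue TS); rewrite -qE.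
Qed.

Lemma upper_S_spectrum_plane : upper_S_spectrum T `<=` complex_plane.
Proof. by move=> q [_ [? _]]. Qed.

Lemma upper_S_spectrum_bound q : upper_S_spectrum T q -> `|q| <= K.
Proof.
move=> /upper_S_spectrum_cplx[_ _ ap]; rewrite leNgt; apply/negP => Kq.
have [|x x1 xd] := ap ((`|q| - K) / 2); first by rewrite divr_gt0// subr_gt0.
have := pair_bound TS x; rewrite x1 mulr1 => TK.
have := lerB_dist (rscale x q) (T x); rewrite norm_rscale x1 mul1r distrC.
lra.
Qed.

(** Closedness is read off approximate eigenvalues, which are stable under limits. *)
Lemma upper_S_spectrum_compact : compact (upper_S_spectrum T).
Proof.
apply: planar_compact upper_S_spectrum_plane _ upper_S_spectrum_bound.
move=> q /closure_normP clq.
have j0 : qj q = 0.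
  apply: (@le_small_eq0 _ _ 1) => d /clq[w /upper_S_spectrum_cplx[wE _ _] wq].
  rewrite mul1r; apply: le_trans wq; apply: le_trans (abs_qj_le _).
  by rewrite wE /= sub0r normrN.
have k0 : qk q = 0.
  apply: (@le_small_eq0 _ _ 1) => d /clq[w /upper_S_spectrum_cplx[wE _ _] wq].
  rewrite mul1r; apply: le_trans wq; apply: le_trans (abs_qk_le _).
  by rewrite wE /= sub0r normrN.
split; last first.
  split; first by split.
  rewrite /= leNgt; apply/negP => qi0.
  have [|w /upper_S_spectrum_cplx[_ wi _] wq] := clq (- qi q / 2).
    by rewrite divr_gt0// oppr_gt0.
  have := le_trans (abs_qi_le (w - q)) wq; rewrite ler_norml /= => /andP[].
  lra.
apply: (approximate_eigenvalue_S_spectrum TS) => d d0.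
have d2 : 0 < d / 2 by rewrite divr_gt0.
have [w /upper_S_spectrum_cplx[_ _ ap] wq] := clq _ d2.
have [x x1 xd] := ap _ d2; exists x => //.
have -> : T x - rscale x q = (T x - rscale x w) + rscale x (w - q).
  by rewrite rscaleBr addrA subrK.
apply: le_trans (ler_normD _ _) _; rewrite norm_rscale x1 mul1r; lra.
Qed.

(* Near a vector whose value [b i] has [b >= c > 0], the function [imn] agrees
   with [qi] up to second order, so that an almost maximiser of
   [al * qre - ga * imn] is an almost critical point of [op_comb al (- ga)]. *)
Lemma almost_maximizer al ga la c : 0 <= ga -> 0 < c ->
  (forall z, al * qre (inner (T z) z) - ga * imn (inner (T z) z) <= la * `|z| ^+ 2) ->
  forall d, 0 < d -> exists2 eta : R, 0 < eta & forall x r b, `|x| = 1 ->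
    inner (T x) x = cplx r b -> c <= b -> la - eta <= al * r - ga * b ->
    `|op_comb al (- ga) x - la *: x| <= d.
Proof.
move=> ga0 c0 Fla d d0; have K0 := pair_ge0 TS.
pose S0 := op_comb al (- ga).
pose L := `|la| + (`|al| + `|- ga|) * K.
have L0 : 0 <= L by rewrite addr_ge0// mulr_ge0// addr_ge0.
have wL x : `|S0 x - la *: x| <= L * `|x|.
  rewrite mulrDl; apply: le_trans (ler_normB _ _) _.
  by rewrite normrZ addrC lerD2l; exact: (op_comb_bound TS).
have phiE x : la * `|x| ^+ 2 - rdot (S0 x) x = - rdot (S0 x - la *: x) x.
  by rewrite !rdotE rdot_norm; ring.
have valE x : rdot (S0 x) x =
    al * qre (inner (T x) x) - ga * qi (inner (T x) x).
  by rewrite op_combE !rdotE (rdot_op_re TS) (rdot_op_im TS) mulNr.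
pose M := 2 * K * L + K * L ^+ 2.
have M0 : 0 <= M by rewrite addr_ge0 ?mulr_ge0 ?exprn_ge0.
pose C := ga * (2 * M ^+ 2 / c).
have C0 : 0 <= C by rewrite !mulr_ge0 ?exprn_ge0// invr_ge0 ltW.
have L3 : 0 <= L ^+ 3 by rewrite exprn_ge0.
(* The second bound keeps [qi] at least [c / 2] along the perturbation; the third absorbs the terms
   of second order. *)
pose t := Num.min 1 (Num.min (c / (2 * (M + 1))) (d ^+ 2 / (L ^+ 3 + C + 1))).
have t0 : 0 < t.
  by rewrite !lt_min ltr01 !divr_gt0 ?exprn_gt0//; lra.
have t1 : t <= 1 by rewrite ge_min lexx.
have tc : t * M <= c / 2.
  have : t * (2 * (M + 1)) <= c.
    by rewrite -ler_pdivlMr ?ge_min ?lexx ?orbT//; lra.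
  lra.
have td : t * (L ^+ 3 + C + 1) <= d ^+ 2.
  by rewrite -ler_pdivlMr ?ge_min ?lexx ?orbT//; lra.
exists (t * d ^+ 2); first by rewrite mulr_gt0// exprn_gt0.
move=> x r b x1 Tx cy max_x.
have [w wE] : exists w, S0 x - la *: x = w by exists (S0 x - la *: x).
have wn : `|w| <= L by rewrite -wE; have := wL x; rewrite x1 mulr1.
rewrite -/S0 wE.
pose z := x + t *: w.
pose v := inner (T z) z.
pose e := inner (T x) w + inner (T w) x; pose f := inner (T w) w.
have Kn u1 u2 : `|inner (T u1) u2| <= K * `|u1| * `|u2|.
  by apply: le_trans (inner_cauchy _ _) _; rewrite ler_wpM2r//; exact: (pair_bound TS).
have vE : v = cplx r b + t *: (e + t *: f).
  rewrite /v /z (linearD T) (linearZZ T) innerDl !innerDr !innerZ !inner_scaler Tx.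
  by rewrite /e /f !scalerDr scalerA -!addrA.
have ef : `|e + t *: f| <= M.
  have h1 : `|inner (T x) w| <= K * L.
    by apply: le_trans (Kn _ _) _; rewrite x1 mulr1 ler_wpM2l.
  have h2 : `|inner (T w) x| <= K * L.
    by apply: le_trans (Kn _ _) _; rewrite x1 mulr1 ler_wpM2l.
  have h3 : `|t *: f| <= K * L ^+ 2.
    rewrite normrZ gtr0_norm// -[leRHS]mul1r; apply: ler_pM => //; first exact: ltW.
    apply: le_trans (Kn _ _) _; rewrite -mulrA -expr2 ler_wpM2l//.
    by rewrite ler_sqr ?nnegrE.
  apply: le_trans (ler_normD _ _) _; have := ler_normD (inner (T x) w) (inner (T w) x).
  by rewrite -/e /M; lra.
have tef : `|t *: (e + t *: f)| <= t * M.
  by rewrite normrZ gtr0_norm// ler_pM2l.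
have vi : c / 2 <= qi v.
  have := le_trans (abs_qi_le _) tef; rewrite ler_norml => /andP[h _].
  by have : qi v = b + qi (t *: (e + t *: f)) by [rewrite vE]; lra.
have vjk : qj v ^+ 2 + qk v ^+ 2 <= (t * M) ^+ 2.
  apply: le_trans (_ : `|t *: (e + t *: f)| ^+ 2 <= _); last first.
    by rewrite ler_sqr ?nnegrE// mulr_ge0// ltW.
  rewrite vE; move: (t *: (e + t *: f)) => q.
  by rewrite sqr_normq /= !add0r; have := sqr_ge0 (qre q); have := sqr_ge0 (qi q); lra.
have vi0 : 0 < qi v by apply: lt_le_trans vi; rewrite divr_gt0.
have imnv : imn v <= qi v + (t * M) ^+ 2 / c.
  apply: le_trans (imn_le_qi vi0) _; rewrite lerD2l.
  apply: ler_pM => //; [by rewrite addr_ge0 ?sqr_ge0|by rewrite invr_ge0 mulr_ge0// ltW|].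
  by rewrite lef_pV2 ?posrE ?mulr_gt0//; lra.
have := Fla z; rewrite -/v => Fz.
have gaim : ga * imn v <= ga * qi v + t ^+ 2 * C.
  have : ga * imn v <= ga * (qi v + (t * M) ^+ 2 / c) by rewrite ler_wpM2l.
  have -> : ga * (qi v + (t * M) ^+ 2 / c) = ga * qi v + t ^+ 2 * (ga * (M ^+ 2 / c)).
    by field; rewrite gt_eqF.
  have : t ^+ 2 * (ga * (M ^+ 2 / c)) <= t ^+ 2 * C.
    rewrite ler_wpM2l ?sqr_ge0// /C ler_wpM2l// -mulrA.
    have : 0 <= M ^+ 2 / c by rewrite divr_ge0 ?sqr_ge0// ltW.
    lra.
  lra.
have low : - (t ^+ 2 * C) <= - rdot (S0 z - la *: z) z.
  by rewrite -phiE valE -/v; lra.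
have phix : - rdot (S0 x - la *: x) x <= t * d ^+ 2.
  by rewrite -phiE valE Tx x1 expr1n /=; lra.
have phiw : - rdot (S0 w - la *: w) w <= L ^+ 3.
  rewrite -rdotNl; apply: le_trans (ler_norm _) _.
  apply: le_trans (rdot_cauchy _ _) _; rewrite normrN.
  have h : `|S0 w - la *: w| <= L * L by apply: le_trans (wL _) _; rewrite ler_wpM2l.
  by rewrite !exprS expr0 mulr1 mulrA; apply: ler_pM.
(* The decrease [2 t |w|^2] must be compensated by [t * d ^+ 2] and by terms of order [t ^+ 2],
   which forces [w] to be small. *)
have phiz : - rdot (S0 z - la *: z) z = - rdot (S0 x - la *: x) x
    - 2 * t * `|w| ^+ 2 + t ^+ 2 * (- rdot (S0 w - la *: w) w).
  have cross : rdot (S0 w - la *: w) x = `|w| ^+ 2.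
    by rewrite -rdot_norm -[X in _ = rdot _ X]wE !rdotE (op_comb_sa TS).
  have Sz : S0 z - la *: z = (S0 x - la *: x) + t *: (S0 w - la *: w).
    rewrite /z (linearD S0) (linearZZ S0) scalerDr opprD addrACA scalerBr.
    by rewrite !scalerA (mulrC la).
  rewrite Sz /z rdotDl rdotZl !rdotDr !rdotZr cross wE rdot_norm.
  by ring.
have {}phiw : t ^+ 2 * (- rdot (S0 w - la *: w) w) <= t ^+ 2 * L ^+ 3.
  by rewrite ler_wpM2l ?sqr_ge0.
rewrite -ler_sqr ?nnegrE ?(ltW d0)//.
have key : t * (2 * `|w| ^+ 2 - (d ^+ 2 + t * (L ^+ 3 + C))) <= 0 by lra.
rewrite pmulr_rle0// in key.
have : t * (L ^+ 3 + C) <= d ^+ 2 by lra.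
lra.
Qed.

End upper_spectrum.

(** * The two inclusions *)

Section inclusions.
Context {R : realType} {H : rightQuaternionicHilbertType R}.
Implicit Types (x y z w : H) (a b c d r t al be ga la m eta : R) (p q : quaternion R).
Context {K : R} {T S : {linear H -> H}} (TS : normal_pair K T S).
Context {e : nat -> H} (eON : forall i j : nat, inner (e i) (e j) = (i == j)%:R).
Local Notation A := (op_re T S).
Local Notation D := (op_im T S).
Local Notation op_comb := (@op_comb R H T S).
Local Notation v0 := (inf (real_bild T)).
Local Notation v1 := (sup (real_bild T)).
Local Notation vertices := (upper_S_spectrum T `|` [set qreal v0; qreal v1]).

Lemma real_bild_has_inf : has_inf (real_bild T).
Proof.
split; first exact: (real_bild_nonempty TS eON).
by exists (- K) => r /(real_bild_bound TS); rewrite ler_norml => /andP[].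
Qed.

Lemma real_bild_has_sup : has_sup (real_bild T).
Proof.
split; first exact: (real_bild_nonempty TS eON).
by exists K => r /(real_bild_bound TS); rewrite ler_norml => /andP[].
Qed.

Lemma inf_real_bild_le r : real_bild T r -> v0 <= r.
Proof. exact: (ge_inf real_bild_has_inf.2). Qed.

Lemma sup_real_bild_ge r : real_bild T r -> r <= v1.
Proof. exact: (ub_le_sup real_bild_has_sup.2). Qed.

Lemma real_segment_closure r : v0 <= r -> r <= v1 -> closure (upper_bild T) (qreal r).
Proof.
move=> r0 r1; apply/closure_normP => eps eps0.
suff [s rs sr] : exists2 s, real_bild T s & `|s - r| <= eps.
  exists (qreal s); first by split; [exact: rs.1|split; [exact: rs.2|rewrite /=]].
  rewrite (_ : _ - _ = qreal (s - r)) ?normq_real//.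
  by apply: quatP; rewrite //= subrr.
have [s0 bs0 ls0] := inf_adherent eps0 real_bild_has_inf.
have [s1 bs1 ls1] := sup_adherent eps0 real_bild_has_sup.
have [rs0|s0r] := leP r s0.
  by exists s0 => //; rewrite ger0_norm ?subr_ge0//; lra.
have [s1r|rs1] := leP s1 r.
  by exists s1 => //; rewrite distrC ger0_norm ?subr_ge0//; lra.
exists r; first exact: (real_bild_interval TS bs0 bs1).
by rewrite subrr normr0 ltW.
Qed.

Lemma upper_S_spectrum_star :
  upper_S_spectrum T `<=` star_kernel (closure (upper_bild T)).
Proof.
move=> p /(upper_S_spectrum_cplx TS)[pE p0 ap] y t Yy t01.
have [t0 t1] := andP t01.
apply/closure_normP => eps eps0; have eps2 : 0 < eps / 2 by rewrite divr_gt0.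
have [q Bq qy] := (closure_normP _ _).1 Yy _ eps2.
rewrite pE in ap; have [w Bw wq] := upper_bild_star TS p0 ap Bq t01 eps2.
rewrite -pE in wq; exists w => //.
have -> : w - ((1 - t) *: y + t *: p) =
    (w - ((1 - t) *: q + t *: p)) + (1 - t) *: (q - y).
  by apply: quatP => /=; ring.
apply: le_trans (ler_normD _ _) _; rewrite normrZ ger0_norm ?subr_ge0//.
have : (1 - t) * `|q - y| <= 1 * `|q - y| by rewrite ler_wpM2r//; lra.
lra.
Qed.

Lemma norm_e0 : `|e 0%N| = 1.
Proof.
apply: sqr_inj_ge0 => //; rewrite -rdot_norm /rdot eON /= expr1n.
by [].
Qed.

Lemma upper_S_spectrum_nonempty : upper_S_spectrum T !=set0.
Proof.
have [|a [b [_ spec]]] := @numerical_range_top _ _ _ _ _ TS 0 0 0.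
  exists (e 0%N); first exact: norm_e0.
  by rewrite op_combE !rdotE !mul0r addr0.
by exists (cplx a `|b|).
Qed.

(** The join [J] of the real segment with the hull of the upper S-spectrum is convex and contains
    the vertices; star-shapedness puts it in the closure. *)
Lemma convex_hull_sub_closure : convex_hull vertices `<=` closure (upper_bild T).
Proof.
pose I : set (quaternion R) := [set q | exists2 r, v0 <= r <= v1 & q = qreal r].
have [r0 br0] := real_bild_nonempty TS eON.
have v01 : v0 <= v1 by apply: le_trans (inf_real_bild_le br0) (sup_real_bild_ge br0).
have convI : @convex_set R (quaternion R) I.
  apply/convex_setP => x y t /andP[t0 t1] [r1 /andP[h1 h2] ->] [r2 /andP[h3 h4] ->].
  exists ((1 - t) * r1 + t * r2); last by apply: quatP => /=; ring.
  have l1 : (1 - t) * v0 <= (1 - t) * r1 by rewrite ler_wpM2l// subr_ge0.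
  have l2 : t * v0 <= t * r2 by rewrite ler_wpM2l.
  have l3 : (1 - t) * r1 <= (1 - t) * v1 by rewrite ler_wpM2l// subr_ge0.
  have l4 : t * r2 <= t * v1 by rewrite ler_wpM2l.
  by apply/andP; split; lra.
pose J := segments I (convex_hull (upper_S_spectrum T)).
have JY : J `<=` closure (upper_bild T).
  move=> _ [x [y [t [[r /andP[r0' r1'] ->] hy t01 ->]]]].
  apply: (convex_hull_star_kernel upper_S_spectrum_star hy) => //.
  exact: real_segment_closure.
apply: subset_trans JY; apply: smallest_sub.
  by apply: convex_segments => //; exact: convex_convex_hull.
have [p0 sp0] := upper_S_spectrum_nonempty.
have one01 : 0 <= (1 : R) <= 1 by rewrite ler01 lexx.
have zero01 : 0 <= (0 : R) <= 1 by rewrite ler01 lexx.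
move=> q [sq|qv].
  exists (qreal v0), q, 1; split => //.
  - by exists v0; rewrite ?lexx.
  - exact: sub_gen_smallest.
  - by rewrite subrr scale0r add0r scale1r.
exists q, p0, 0; split => //.
- by case: qv => ->; [exists v0|exists v1]; rewrite ?lexx ?v01.
- exact: sub_gen_smallest.
- by rewrite subr0 scale1r scale0r addr0.
Qed.

Lemma vertices_plane : vertices `<=` complex_plane.
Proof.
by move=> q [/upper_S_spectrum_plane//|[->|->]]; split.
Qed.

Lemma vertices_compact : compact vertices.
Proof.
apply: compactU; first exact: (upper_S_spectrum_compact TS).
by apply: compactU; exact: compact_set1.
Qed.

Lemma convex_hull_plane : convex_hull vertices `<=` complex_plane.
Proof.
apply: smallest_sub vertices_plane; apply/convex_setP.
by move=> x y t _ [xj xk] [yj yk]; split; rewrite /= ?xj ?xk ?yj ?yk !mulr0 addr0.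
Qed.

(** [numerical_range_top] gives a joint point [(a, b)] at least as high, and replacing [b] by its
    absolute value only raises it. *)
Lemma upper_bild_support_ge0 al be m q : 0 <= be ->
  (forall p, upper_S_spectrum T p -> al * qre p + be * qi p <= m) ->
  upper_bild T q -> al * qre q + be * qi q <= m.
Proof.
move=> be0 sm [[x x1 xq] _]; set c := leLHS.
have [|a [b [cab /sm]]] := @numerical_range_top _ _ _ _ _ TS al be c.
  exists x => //; rewrite op_combE !rdotE (rdot_op_re TS) (rdot_op_im TS) xq.
  exact: lexx.
apply: le_trans; apply: le_trans cab _ => /=.
by rewrite lerD2l ler_wpM2l// ler_norm.
Qed.

Lemma real_bild_support al m r : al * v0 <= m -> al * v1 <= m ->
  real_bild T r -> al * r <= m.
Proof.
move=> m0 m1 br; have [al0|al0] := leP 0 al.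
  by apply: le_trans m1; rewrite ler_wpM2l// sup_real_bild_ge.
by apply: le_trans m0; rewrite ler_nM2l// inf_real_bild_le.
Qed.

(* The crucial half-planes are those bounded below, where [imn] is to be made
   small. Either an almost maximiser of [al * qre - ga * imn] has [imn] bounded
   away from [0], and then it is almost an eigenvector; or [imn] tends to [0],
   and then a nearby vector has a real value, unless [op_im] tends to [0]. *)
Lemma upper_bild_support_lt0 al ga m q : 0 < ga -> al * v0 <= m -> al * v1 <= m ->
  (forall p, upper_S_spectrum T p -> al * qre p - ga * qi p <= m) ->
  upper_bild T q -> al * qre q - ga * qi q <= m.
Proof.
move=> ga0 mv0 mv1 sm [[x0 /= x01 x0q] [[qj0 qk0] qi0]]; rewrite leNgt; apply/negP => mq.
have K0 := pair_ge0 TS.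
pose F z := al * qre (inner (T z) z) - ga * imn (inner (T z) z).
have reK z : `|z| = 1 -> `|qre (inner (T z) z)| <= K.
  move=> z1; apply: le_trans (abs_qre_le _) _; apply: le_trans (inner_cauchy _ _) _.
  by have := pair_bound TS z; rewrite z1 !mulr1.
pose V := [set F z | z in [set z : H | `|z| = 1]].
have V_sup : has_sup V.
  split; first by exists (F x0), x0.
  exists (`|al| * K) => _ [z /= z1 <-]; rewrite /F.
  have : al * qre (inner (T z) z) <= `|al| * K.
    apply: le_trans (ler_norm _) _; rewrite normrM ler_wpM2l//; exact: reK.
  have : 0 <= ga * imn (inner (T z) z) by rewrite mulr_ge0 ?imn_ge0// ltW.
  lra.
pose la := sup V.
have FV z : `|z| = 1 -> F z <= la.
  by move=> z1; apply: (ub_le_sup V_sup.2); exists z.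
have mla : m < la.
  apply: lt_le_trans (FV _ x01); apply: lt_le_trans mq _; rewrite /F x0q.
  suff -> : imn q = qi q by [].
  by apply: sqr_inj_ge0; rewrite ?imn_ge0// sqr_imn qj0 qk0; ring.
have Fla z : F z <= la * `|z| ^+ 2.
  have FZ a w : F (a *: w) = a ^+ 2 * F w.
    have aa : `|a| ^+ 2 = a ^+ 2 by rewrite real_normK ?num_real.
    by rewrite /F (linearZZ T) innerZ inner_scaler !imnZ /=; ring: aa.
  have [->|nz0] := eqVneq z 0.
    by rewrite -(scale0r (0 : H)) FZ normrZ normr0 mul0r expr0n/= mul0r mulr0.
  have n0 : 0 < `|z| by rewrite normr_gt0.
  have := FV (`|z|^-1 *: z); rewrite normrZ normfV normr_id mulVf ?gt_eqF// FZ.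
  by move=> /(_ erefl); rewrite exprVn ler_pdivrMl ?exprn_gt0// mulrC.
have [c c0 [d0 d00 far]] : exists2 c, 0 < c & exists2 d, 0 < d &
    forall z, `|z| = 1 -> la - d <= F z -> c <= imn (inner (T z) z).
  apply: contrapT => nofar.
  have near d : 0 < d -> exists z, [/\ `|z| = 1, la - d <= F z & imn (inner (T z) z) < d].
    move=> d0; apply: contrapT => nonear; apply: nofar.
    exists d => //; exists d => // z z1 Fz.
    by rewrite leNgt; apply/negP => imz; apply: nonear; exists z.
  have Fre z : F z <= al * rdot (A z) z.
    rewrite (rdot_op_re TS) /F lerBlDr lerDl mulr_ge0 ?imn_ge0//; exact: ltW.
  (* If [|D z|] can be kept above some [c], a nearby real value [r] has [al * r > m]; otherwise
     [D z] tends to 0 and a spectral point lies beyond [m]. *)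
  have [[c [c0 nearc]]|nonearc] := pselect (exists c, 0 < c /\ forall d, 0 < d ->
      exists z, [/\ `|z| = 1, la - d <= F z, imn (inner (T z) z) < d & c <= `|D z|]).
    pose eta := (la - m) / (4 * (`|al| + 1)).
    have al1 : 0 < 4 * (`|al| + 1) by rewrite mulr_gt0// ltr_wpDl.
    have eta0 : 0 < eta by rewrite divr_gt0// subr_gt0.
    have etaE : eta * (4 * (`|al| + 1)) = la - m by rewrite divfK// gt_eqF.
    have [eps eps0 value] := near_real_value TS c0 eta0.
    pose d := Num.min eps ((la - m) / 4).
    have d0 : 0 < d by rewrite lt_min eps0 divr_gt0// subr_gt0.
    have [z [z1 Fz imz Dz]] := nearc _ d0.
    have deps : d <= eps by rewrite ge_min lexx.
    have dm : d <= (la - m) / 4 by rewrite ge_min lexx orbT.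
    have [r br rz] := value _ z1 Dz (ltW (lt_le_trans imz deps)).
    have := real_bild_support mv0 mv1 br.
    have : `|al * r - al * rdot (A z) z| <= `|al| * eta.
      by rewrite -mulrBr normrM ler_wpM2l.
    rewrite ler_norml => /andP[h _]; have := Fre z; lra.
  have [|a [b [b0 ab spec]]] := @null_op_im_top _ _ _ _ _ TS al (- ga) la.
    move=> d d0.
    have [d1 d10 small] : exists2 d1, 0 < d1 & forall z, `|z| = 1 -> la - d1 <= F z ->
        imn (inner (T z) z) < d1 -> `|D z| <= d.
      apply: contrapT => nosmall; apply: nonearc; exists d; split => // d1 d10.
      apply: contrapT => noz; apply: nosmall; exists d1 => // z z1 Fz imz.
      by rewrite leNgt; apply/negP => Dz; apply: noz; exists z; split => //; exact: ltW.
    have dd : 0 < Num.min d d1 by rewrite lt_min d0.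
    have [z [z1 Fz imz]] := near _ dd.
    have hd : Num.min d d1 <= d by rewrite ge_min lexx.
    have hd1 : Num.min d d1 <= d1 by rewrite ge_min lexx orbT.
    exists z; split => //; last by have := Fre z; lra.
    by apply: small => //; [lra|exact: lt_le_trans imz hd1].
  by have := sm _ spec; rewrite /=; lra.
(* Almost maximisers, rotated to have their values in the upper half-plane, are almost eigenvectors
   for [la]; the resulting spectral point on the line at level [la > m] is contradictory. *)
have [|a [b [cb ab spec]]] := @joint_spectrum_above _ _ _ _ _ TS al (- ga) la c.
  move=> d dpos.
  have [eta eta0 crit] := almost_maximizer TS (ltW ga0) c0 Fla dpos.
  have min0 : 0 < Num.min eta d0 by rewrite lt_min eta0.
  have [_ [z /= z1 <-] Fz] := sup_adherent min0 V_sup.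
  have heta : Num.min eta d0 <= eta by rewrite ge_min lexx.
  have hd0 : Num.min eta d0 <= d0 by rewrite ge_min lexx orbT.
  rewrite -/la in Fz.
  have cz : c <= imn (inner (T z) z) by apply: far => //; lra.
  have [u u1 uE] := rotate_to_cplx (inner (T z) z).
  have z'1 : `|rscale z u| = 1 by rewrite norm_rscale z1 u1 mulr1.
  have Tz' : inner (T (rscale z u)) (rscale z u) =
      cplx (qre (inner (T z) z)) (imn (inner (T z) z)).
    by rewrite -uE (pair_rscale TS) innerZl innerZr.
  exists (rscale z u); split => //.
    by apply: (crit _ _ _ z'1 Tz' cz); rewrite -/(F z); lra.
  by rewrite (rdot_op_im TS) Tz' /=; lra.
have b0 : 0 < b by exact: lt_le_trans cb.
have := sm _ spec; rewrite /= gtr0_norm//; lra.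
Qed.

(** A point of the upper bild outside the closed hull would be separated from it by a line, which
    the support lemmas exclude for either sign of [be]. *)
Lemma closure_sub_convex_hull : closure (upper_bild T) `<=` convex_hull vertices.
Proof.
have cX := compact_planar_convex_hull vertices_plane vertices_compact.
have clX : closed (convex_hull vertices).
  by apply: compact_closed cX; exact: norm_hausdorff.
rewrite [X in _ `<=` X](closure_id _).1//; apply: closureS => q Bq.
apply: contrapT => nXq.
have X0 : convex_hull vertices !=set0.
  by exists (qreal v0); apply: sub_gen_smallest; right; left.
have qC : complex_plane q by case: Bq => _ [].
have [al [be [m [mq Xm]]]] := planar_separation convex_hull_plane cX X0
  (@convex_convex_hull _ _ _) qC nXq.
have sm p : upper_S_spectrum T p -> al * qre p + be * qi p <= m.
  by move=> sp; apply: Xm; apply: sub_gen_smallest; left.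
have [be0|be0] := leP 0 be.
  by have := upper_bild_support_ge0 be0 sm Bq; lra.
have mv0 : al * v0 <= m.
  have := Xm (qreal v0); rewrite /= mulr0 addr0; apply.
  by apply: sub_gen_smallest; right; left.
have mv1 : al * v1 <= m.
  have := Xm (qreal v1); rewrite /= mulr0 addr0; apply.
  by apply: sub_gen_smallest; right; right.
have ga0 : 0 < - be by lra.
have sm' p : upper_S_spectrum T p -> al * qre p - (- be) * qi p <= m.
  by move=> /sm; lra.
have := upper_bild_support_lt0 ga0 mv0 mv1 sm' Bq; lra.
Qed.

End inclusions.

Theorem theorem4p2 (R : realType) (H : rightQuaternionicHilbertType R)
    (H_basis : exists e : nat -> H, orthonormal_basis e)
    (T : H -> H) (T_bounded : bounded_operators T)
    (T_normal : normal_operator T) :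
  closure (upper_bild T) =
  convex_hull (upper_S_spectrum T `|`
    [set qreal (inf (real_bild T)); qreal (sup (real_bild T))]).
Proof.
have [e [eON _]] := H_basis.
have [K [T' [S [-> TS]]]] := normal_pair_exists T_bounded T_normal.
apply/seteqP; split; first exact: (closure_sub_convex_hull TS eON).
exact: (convex_hull_sub_closure TS eON).
Qed.
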